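(* Let $X$ be a completely regular space, $p\in[1,+\infty)$, and let $\varrho:\mathfrak C[X]\times\mathfrak C[X]\to[0,+\infty]$ be an extended metric on $\mathfrak C[X]$ such that $\varrho^p$ is radially $1$-homogeneous, proper and lower semicontinuous. For $\mu_1,\mu_2\in\mathcal M_+(X)$ set $$\mathcal D_{\varrho,p}(\mu_1,\mu_2):=\Big(\inf\Big\{\int_{\mathfrak C[X]\times\mathfrak C[X]}\varrho^p\,d\alpha:\alpha\in\mathfrak H^1(\mu_1,\mu_2)\Big\}\Big)^{1/p},$$ and let $$\mathcal M_{\varrho,p}(X):=\Big\{\mu\in\mathcal M_+(X):\int_X\varrho^p([x,1],\mathfrak o)\,d\mu(x)<+\infty\Big\}.$$ Then $(\mathcal M_+(X),\mathcal D_{\varrho,p})$ is an extended metric space and $(\mathcal M_{\varrho,p}(X),\mathcal D_{\varrho,p})$ is a metric space.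
   Context: Completely regular spaces are assumed Hausdorff; $\mathcal M_+(X)$ is the set of finite nonnegative Radon measures on $X$. An extended metric satisfies the axioms of a metric but may take the value $+\infty$. Cone: $\mathfrak C[X]=(X\times[0,+\infty))/\sim$, where $(x,r)\sim(y,s)$ iff ($x=y$ and $r=s\neq0$) or $r=s=0$; $[x,r]$ is the class of $(x,r)$ and $\mathfrak o=[x,0]$ the vertex. A neighbourhood base at $[x,r]$ with $r>0$ is given by the images of the neighbourhoods of $(x,r)$ in the product topology; at $\mathfrak o$ by the sets $\{[x,r]:0\le r<\varepsilon\}$, $\varepsilon>0$. $\mathfrak C[X]\times\mathfrak C[X]$ has the product topology, and lower semicontinuity refers to it. $H:\mathfrak C[X]\times\mathfrak C[X]\to[0,+\infty]$ is proper if not identically $+\infty$, and radially $1$-homogeneous if $H([x_1,\lambda r_1],[x_2,\lambda r_2])=\lambda H([x_1,r_1],[x_2,r_2])$ for all $\lambda>0$, $x_i\in X$, $r_i\ge0$. $\mathfrak H^1(\mu_1,\mu_2)$ is the set of nonnegative finite Radon measures $\alpha$ on $\mathfrak C[X]\times\mathfrak C[X]$ with $\int(r_1+r_2)\,d\alpha<+\infty$ and $\mu_i(A)=\int_{\{r_i>0,\ x_i\in A\}}r_i\,d\alpha([x_1,r_1],[x_2,r_2])$ for every Borel $A\subset X$, $i=1,2$. *)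

(* Defs.v *)
From HB Require Import structures.
From mathcomp Require Import all_boot all_order all_algebra.
From mathcomp Require Import generic_quotient.
From mathcomp Require Import all_classical all_reals all_analysis.

Set Implicit Arguments.
Unset Strict Implicit.
Unset Printing Implicit Defensive.

Import Order.TTheory GRing.Theory Num.Theory.
Import numFieldNormedType.Exports.

Local Open Scope quotient_scope.
Local Open Scope classical_set_scope.
Local Open Scope ring_scope.

(* The library puts no topology on {nonneg R}; it gets the one induced by R. *)
HB.instance Definition _ (R : realType) :=
  Topological.copy {nonneg R}
    (initial_topology (fun r : {nonneg R} => r%:num : R)).

Section cone_def.
Context {X : topologicalType} {R : realType}.

Definition cone_rel_fun (a b : X * {nonneg R}) : bool :=
  [&& a.1 == b.1, a.2%:num == b.2%:num & b.2%:num != 0]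
  || (a.2%:num == 0) && (b.2%:num == 0).

Let cone_rel_refl : reflexive cone_rel_fun.
Proof.
by move=> [x r]; rewrite /cone_rel_fun /= !eqxx /=; case: (_ == 0).
Qed.

Let cone_rel_sym : symmetric cone_rel_fun.
Proof.
move=> [x r] [y s]; rewrite /cone_rel_fun /= (eq_sym y x) (eq_sym s%:num r%:num).
by rewrite (andbC (s%:num == 0)); case: (r%:num =P s%:num) => // ->.
Qed.

Let cone_rel_trans : transitive cone_rel_fun.
Proof.
move=> [y s] [x r] [z t]; rewrite /cone_rel_fun /=.
case/orP => [/and3P[/eqP -> /eqP -> s0]|/andP[r0 s0]].
  by rewrite (negbTE s0) /= ?orbF.
by rewrite s0 r0 /= => /orP[/and3P[_ /eqP <-]|->]; rewrite ?s0 ?orbT.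
Qed.

Definition cone_rel := EquivRel _ cone_rel_refl cone_rel_sym cone_rel_trans.

End cone_def.

Definition cone (X : topologicalType) (R : realType) : Type :=
  {eq_quot (@cone_rel X R)}.

Section cone_theory.
Context {X : topologicalType} {R : realType}.
Local Notation C := (cone X R).

HB.instance Definition _ := Choice.copy C {eq_quot (@cone_rel X R)}.

Definition cpt (x : X) (r : {nonneg R}) : C :=
  \pi_({eq_quot (@cone_rel X R)}) (x, r).

Definition crepr (z : C) : X * {nonneg R} :=
  repr (z : {eq_quot (@cone_rel X R)}).

(* [cbase z] is an arbitrary point of X when z is the vertex. *)
Definition cbase (z : C) : X := (crepr z).1.
Definition cradius (z : C) : R := (crepr z).2%:num.

Lemma cpt_repr (z : C) : cpt (cbase z) (crepr z).2 = z.
Proof. by rewrite /cpt /cbase -surjective_pairing /crepr reprK. Qed.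

Lemma cpt_eqP (x y : X) (r s : {nonneg R}) :
  cpt x r = cpt y s <->
  (x = y /\ r%:num = s%:num /\ s%:num <> 0) \/ (r%:num = 0 /\ s%:num = 0).
Proof.
split.
  move=> /eqmodP; rewrite /= /cone_rel_fun /=.
  move=> /orP[/and3P[/eqP -> /eqP -> /eqP s0]|/andP[/eqP r0 /eqP s0]].
    by left.
  by right.
move=> H; apply/eqmodP; rewrite /= /cone_rel_fun /=.
case: H => [[-> [-> /eqP ->]]|[-> ->]]; first by rewrite !eqxx.
by rewrite eqxx orbT.
Qed.

Lemma cradiusE x r : cradius (cpt x r) = r%:num.
Proof.
by case/cpt_eqP : (cpt_repr (cpt x r)) => [[_ [? _]]|[rz ->]].
Qed.

Lemma cbaseE x r : r%:num != 0 -> cbase (cpt x r) = x.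
Proof.
by move=> /eqP r0; case/cpt_eqP : (cpt_repr (cpt x r)) => [[]//|[_ /r0]].
Qed.

Lemma crepr_cpt x r : r%:num != 0 -> crepr (cpt x r) = (x, r).
Proof.
move=> r0; rewrite [LHS]surjective_pairing; congr (_, _).
  exact: cbaseE.
by apply/val_inj; exact: (cradiusE x r).
Qed.

(* This is not the quotient topology: at the vertex the neighbourhoods are
   generated by the balls [cradius w < e] only. Elsewhere, the filter generated
   by the images of neighbourhoods is the image filter. *)
Definition cone_nbhs (z : C) : set_system C :=
  if cradius z == 0 then
    filter_from [set e : R | 0 < e] (fun e => [set w | cradius w < e])
  else (fun a => cpt a.1 a.2) @ nbhs (crepr z).

HB.instance Definition _ := hasNbhs.Build C cone_nbhs.

Let cone_nbhs_filter (z : C) : ProperFilter (nbhs z).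
Proof.
rewrite /nbhs /= /cone_nbhs; case: ifPn => z0.
  apply: filter_from_proper; last first.
    by move=> e e0; exists z; rewrite /= (eqP z0).
  apply: filter_from_filter; first by exists 1; rewrite /= ltr01.
  move=> i j i0 j0; exists (Num.min i j).
    by rewrite /= lt_min i0.
  by move=> w /=; rewrite lt_min => /andP.
exact: fmap_proper_filter.
Qed.

Let cone_nbhs_singleton (z : C) (A : set C) : nbhs z A -> A z.
Proof.
rewrite /nbhs /= /cone_nbhs; case: ifPn => z0.
  by move=> [e /= e0]; apply; rewrite /= (eqP z0).
by move=> /nbhs_singleton /=; rewrite cpt_repr.
Qed.

Lemma nonneg_num_continuous :
  continuous (fun r : {nonneg R} => r%:num : R).
Proof. exact: initial_continuous. Qed.

Lemma snd_num_continuous :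
  continuous (fun a : X * {nonneg R} => a.2%:num : R).
Proof.
move=> a; apply: (@cvg_comp _ _ _ snd (fun r : {nonneg R} => r%:num : R)).
  exact: cvg_snd.
exact: nonneg_num_continuous.
Qed.

Let cone_nbhs_nbhs (z : C) (A : set C) : nbhs z A -> nbhs z (nbhs^~ A).
Proof.
rewrite {1 2}/nbhs /= {1 2}/cone_nbhs; case: ifPn => z0.
  move=> [e /= e0 eA]; exists e => //= w we.
  rewrite /nbhs /= /cone_nbhs; case: ifPn => w0; first by exists e.
  have : \forall a \near crepr w, (a.2%:num : R) < e.
    exact: (@snd_num_continuous (crepr w) _ (lt_nbhsl we)).
  by apply: filterS => a ae /=; apply: eA; rewrite /= cradiusE.
move=> /nbhs_interior nA.
have : \forall a \near crepr z, (a.2%:num : R) != 0.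
  have z1 : 0 < (crepr z).2%:num by rewrite lt0r z0 /=.
  have : \forall a \near crepr z, 0 < (a.2%:num : R).
    exact: (@snd_num_continuous (crepr z) _ (lt_nbhsr z1)).
  by apply: filterS => a; exact: lt0r_neq0.
move: nA => /= /filterI /[apply]; apply: filterS => -[x r] /= [nA r0].
by rewrite /nbhs /= /cone_nbhs cradiusE (negbTE r0) crepr_cpt.
Qed.

HB.instance Definition _ := Nbhs_isNbhsTopological.Build C
  cone_nbhs_filter cone_nbhs_singleton cone_nbhs_nbhs.

End cone_theory.

(* Library measurable types are pointed, so X is taken pointed, i.e. nonempty;
   for empty X the cone is empty and has neither a vertex nor a proper cost. *)
Section vertex.
Context {X : ptopologicalType} {R : realType}.

Definition vertex : cone X R := cpt point 0%:nng.

Lemma vertexE (x : X) : cpt x 0%:nng = vertex.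
Proof. by apply/cpt_eqP; right. Qed.

HB.instance Definition _ := isPointed.Build (cone X R) vertex.

End vertex.

HB.instance Definition _ (T U : ptopologicalType) := Pointed.on (T * U)%type.

Notation borel T := (g_sigma_algebraType (@open T)).

(* Only used for Hausdorff T, where compact sets are Borel. *)
Section radon.
Context {T : ptopologicalType} {R : realType}.
Local Open Scope ereal_scope.

(* Library measures are functions on all subsets; requiring the value 0 off
   the Borel sets makes [mu = nu] equivalent to agreement on Borel sets. *)
Definition Mplus : set {finite_measure set (borel T) -> \bar R} :=
  [set mu |
    (forall A : set (borel T), measurable A ->
       mu A = ereal_sup [set mu K | K in [set K : set T |
                                          compact K /\ K `<=` A]])
    /\ (forall A : set (borel T), ~ measurable A -> mu A = 0)].

End radon.
Arguments Mplus : clear implicits.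

Section metric.
Context {T : Type} {R : realType}.
Local Open Scope ereal_scope.

Definition extended_metric_on (S : set T) (d : T -> T -> \bar R) : Prop :=
  [/\ forall x y, S x -> S y -> 0 <= d x y,
      forall x y, S x -> S y -> (d x y = 0 <-> x = y),
      forall x y, S x -> S y -> d x y = d y x &
      forall x y z, S x -> S y -> S z -> d x z <= d x y + d y z].

Definition metric_on (S : set T) (d : T -> T -> \bar R) : Prop :=
  extended_metric_on S d /\ (forall x y, S x -> S y -> d x y < +oo).

End metric.

Section cone_transport.
Context {X : ptopologicalType} {R : realType}.
Local Notation C := (cone X R).
Local Open Scope ereal_scope.

Definition proper_cost (H : C * C -> \bar R) : Prop := exists z, H z <> +oo.

Definition radially_1_homogeneous (H : C * C -> \bar R) : Prop :=
  forall (l : {posnum R}) (x1 x2 : X) (r1 r2 : {nonneg R}),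
    H (cpt x1 (l%:num * r1%:num)%:nng%R, cpt x2 (l%:num * r2%:num)%:nng%R)
    = l%:num%:E * H (cpt x1 r1, cpt x2 r2).

Definition homogeneous_marginal
    (alpha : {finite_measure set (borel (C * C)%type) -> \bar R})
    (pr : C * C -> C) (mu : {finite_measure set (borel X) -> \bar R}) : Prop :=
  forall A : set (borel X), measurable A ->
    mu A = \int[alpha]_(z in [set z | (0 < cradius (pr z))%R /\
                                      A (cbase (pr z))]) (cradius (pr z))%:E.

Definition H1 (mu1 mu2 : {finite_measure set (borel X) -> \bar R}) :
    set {finite_measure set (borel (C * C)%type) -> \bar R} :=
  [set alpha | [/\ Mplus (C * C)%type R alpha,
    \int[alpha]_z (cradius z.1 + cradius z.2)%:E < +oo,
    homogeneous_marginal alpha fst mu1 &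
    homogeneous_marginal alpha snd mu2]].

Definition Dcone (rho : C -> C -> \bar R) (p : R)
    (mu1 mu2 : {finite_measure set (borel X) -> \bar R}) : \bar R :=
  (ereal_inf [set \int[alpha]_z (rho z.1 z.2 `^ p) | alpha in H1 mu1 mu2])
    `^ p^-1.

Definition Mplus_rho (rho : C -> C -> \bar R) (p : R) :
    set {finite_measure set (borel X) -> \bar R} :=
  [set mu | Mplus X R mu /\ \int[mu]_x (rho (cpt x 1%:nng%R) vertex `^ p) < +oo].

End cone_transport.

(* Main.v *)
Require Import Defs.
From HB Require Import structures.
From mathcomp Require Import all_boot all_order all_algebra.
From mathcomp Require Import all_classical all_reals all_analysis.
From mathcomp Require Import measurable_realfun.
From mathcomp Require Import ring.

Set Implicit Arguments.
Unset Strict Implicit.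
Unset Printing Implicit Defensive.

Import Order.TTheory GRing.Theory Num.Theory.
Import numFieldNormedType.Exports.

Local Open Scope classical_set_scope.
Local Open Scope ring_scope.

(** The distance is a p-th root of an infimum of transport costs over plans on
    the cone, and the three nontrivial axioms are proved on plans.

    Triangle inequality. Given a plan from [mu1] to [mu2] and one from [mu2] to
    [mu3], [plan_glue] builds a plan from [mu1] to [mu3]. Homogeneity of the
    cost allows each plan to be rescaled so that its middle entry has radius 1
    or 0; the parts with radius 1 have the same middle marginal [mu2] and are
    glued over it, and the triangle inequality of the distance on the cone is
    integrated against the result. The powers are handled by the weighted
    convexity inequality [powR_weighted_convexity], which plays the role of
    Minkowski's inequality.

    Gluing Radon measures on arbitrary Hausdorff spaces is the heart of the
    proof ([radon_gluing]). Instead of being disintegrated, the measures are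
    glued over finite partitions of the common factor, and an ultrafilter limit
    over finer and finer partitions is a finitely additive set function on the
    product sigma-algebra with the right marginals. Since the marginals are
    inner regular for compact sets, rectangles can be approximated by compact
    rectangles, and such a set function extends to a Radon measure on the Borel
    sets of the product, a larger sigma-algebra in general
    ([radon_extension]).

    Definiteness. For disjoint compact sets [K] and [L], the cost is bounded
    below on compact sets of pairs off the diagonal, by lower semicontinuity;
    near the vertex, neighbourhoods only restrict the radius, so there the
    bound is uniform in the base point. This yields a pointwise inequality
    between 1-homogeneous functions whose integral against plans of small cost
    says that [mu K <= nu K] ([plan_cost0_le]). Inner regularity and symmetry
    give [mu = nu].

    Symmetry is the exchange of the two entries of a plan. Finiteness on
    [Mplus_rho] comes from the plan that moves all the mass through the vertex
    ([vertex_plan]). *)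

(** * Radon measures *)

Section radon_measures.
Context {R : realType} {T : ptopologicalType}.
Hypothesis hT : hausdorff_space T.
Local Open Scope ereal_scope.
Implicit Types (A K : set (borel T)).

(** For a finite measure on a Hausdorff space this is equivalent to the
    supremum formula in [Mplus]; the epsilon form is the one that is stable
    under densities, images and sums. *)
Definition inner_regular (m : set (borel T) -> \bar R) :=
  forall A, measurable A -> forall e : R, (0 < e)%R ->
  exists K : set T, [/\ compact K, K `<=` A & m (A `\` K) <= e%:E].

Lemma open_borel (U : set T) : open U -> measurable (U : set (borel T)).
Proof. by move=> oU; apply: sub_sigma_algebra. Qed.

Lemma closed_borel (F : set T) : closed F -> measurable (F : set (borel T)).
Proof.
move=> cF; have oF : open (~` F) by exact: closed_openC.
by rewrite -[F]setCK; apply: measurableC; exact: open_borel.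
Qed.

Lemma compact_borel (K : set T) : compact K -> measurable (K : set (borel T)).
Proof. by move=> cK; apply: closed_borel; exact: compact_closed. Qed.

Lemma Mplus_inner_regular (mu : {finite_measure set (borel T) -> \bar R}) :
  Mplus T R mu -> inner_regular mu.
Proof.
move=> [muK _] A mA e e0.
have Afin : mu A \is a fin_num by exact: fin_num_measure.
have /(_ _) := @ub_ereal_sup_adherent R [set mu K | K in [set K : set T |
  compact K /\ K `<=` A]] e e0.
rewrite -muK// => /(_ Afin) [_ [K [cK KA] <-]] AK.
exists K; split => //; have mK := compact_borel cK.
rewrite measureD//; last by rewrite ltey_eq Afin.
rewrite (setIidr KA) leeBlDr ?fin_num_measure// -leeBlDl ?fin_num_measure//.
exact: ltW.
Qed.

(** Every finite inner regular Borel measure has a representative in [Mplus]: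
    it is cut off to 0 outside the Borel sets. All plans below are built as
    plain measures and normalised by this lemma. *)
Lemma exists_Mplus (f : {measure set (borel T) -> \bar R}) :
  f setT < +oo -> inner_regular f ->
  exists2 m : {finite_measure set (borel T) -> \bar R},
    Mplus T R m & forall A, measurable A -> m A = f A.
Proof.
move=> fT fK; pose g A := if pselect (measurable A) then f A else 0.
have gE A : measurable A -> g A = f A by rewrite /g; case: pselect.
have g0 : g set0 = 0 by rewrite gE.
have g_ge0 A : 0 <= g A by rewrite /g; case: pselect.
have gsig : semi_sigma_additive g.
  move=> F mF tF mUF; rewrite gE//.
  under eq_fun do under eq_bigr do rewrite gE//.
  exact: measure_semi_sigma_additive.
pose G := isMeasure.Build _ _ _ g g0 g_ge0 gsig.
pose gm : {measure set (borel T) -> \bar R} := HB.pack g G.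
have gfin : fin_num_fun gm.
  move=> A mA; rewrite ge0_fin_numE// [gm A]gE// (le_lt_trans _ fT)//.
  by rewrite le_measure ?inE.
pose F := @Measure_isFinite.Build _ _ _ (Measure.sort gm) gfin.
pose gf : {finite_measure set (borel T) -> \bar R} := HB.pack (Measure.sort gm) F.
exists gf => //; split => [A mA|A]; last by rewrite /= /g; case: pselect.
apply/eqP; rewrite eq_le; apply/andP; split; last first.
  apply: ge_ereal_sup => _ [K [cK KA] <-].
  have mK := compact_borel cK.
  by rewrite le_measure ?inE.
apply/lee_addgt0Pr => e e0; have [K [cK KA AK]] := fK _ mA _ e0.
have mK := compact_borel cK.
have -> : gf A = f K + f (A `\` K).
  rewrite [gf A]gE// -measureU// ?setDUK//; first exact: measurableD.
  by rewrite setDE setIC -setIA setICl setI0.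
apply: leeD => //; apply: ereal_sup_ubound; exists K => //=; exact: gE.
Qed.

Lemma finite_measure_ext (m n : {finite_measure set (borel T) -> \bar R}) :
  (forall A, m A = n A) -> m = n.
Proof.
move=> /funext; case: m => m cm; case: n => n cn /= mn.
move: cm cn; rewrite mn => cm cn; congr (FiniteMeasure.Pack _).
case: cm => [[a1 a2] [a3] [a4] [a5] [a6]]; case: cn => [[b1 b2] [b3] [b4] [b5] [b6]].
rewrite (Prop_irrelevance a1 b1) (Prop_irrelevance a2 b2).
rewrite (Prop_irrelevance a3 b3) (Prop_irrelevance a4 b4).
by rewrite (Prop_irrelevance a5 b5) (Prop_irrelevance a6 b6).
Qed.

(** A measure is a record on top of a set function, so equality also involves
    the proof fields; these are propositions, hence irrelevant. *)
Lemma Mplus_eq (m n : {finite_measure set (borel T) -> \bar R}) :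
  Mplus T R m -> Mplus T R n ->
  (forall A, measurable A -> m A = n A) -> m = n.
Proof.
move=> [_ m0] [_ n0] mn; apply: finite_measure_ext => A.
have [mA|nA] := pselect (measurable A); first exact: mn.
by rewrite m0 ?n0.
Qed.

(** Regularity only depends on the null sets: if compact sets exhaust [A] up to
    an [a]-null set, they exhaust it up to an [n]-null set, and continuity from
    above for the finite measure [n] makes the remainder small. This covers
    all measures with a density, restrictions included. *)
Lemma inner_regular_dominated (a n : {measure set (borel T) -> \bar R}) :
  n setT < +oo -> inner_regular a ->
  (forall A, measurable A -> a A = 0 -> n A = 0) -> inner_regular n.
Proof.
move=> nT aK an A mA e e0.
have /choice[K KP] (k : nat) : exists K : set T,
    [/\ compact K, K `<=` A & a (A `\` K) <= (k.+1%:R^-1)%:E].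
  by apply: aK => //; rewrite invr_gt0.
pose L k := \big[setU/set0]_(i < k.+1) K i.
have cL k : compact (L k).
  by rewrite /L; apply: bigsetU_compact => i _; case: (KP i).
have mL k : measurable (A `\` L k : set (borel T)).
  by apply: measurableD => //; exact: compact_borel.
have KL k : K k `<=` L k by rewrite /L big_ord_recr/=; right.
(* The part of A missed by all the compact sets [L k] is [a]-null. *)
pose N := \bigcap_k (A `\` L k).
have mN : measurable (N : set (borel T)) by exact: bigcapT_measurable.
have aN : a N = 0.
  apply/eqP; rewrite eq_le measure_ge0 andbT.
  apply/lee_addgt0Pr => d d0; rewrite add0e.
  have [k kd] : exists k, (k.+1%:R^-1 <= d)%R.
    exists (Num.trunc d^-1).
    rewrite -[leRHS]invrK lef_pV2 ?posrE ?invr_gt0//.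
    exact/ltW/truncnS_gt.
  have [_ _ Kd] := KP k.
  apply: (@le_trans _ _ (a (A `\` K k))).
    rewrite le_measure ?inE//.
      by apply: measurableD => //; apply: compact_borel; case: (KP k).
    by move=> x /(_ k Logic.I)[Ax nLx]; split => // /KL.
  by rewrite (le_trans Kd)// lee_fin.
have : n (A `\` L k) @[k --> \oo] --> n N.
  apply: nonincreasing_cvg_mu => //.
    by rewrite (le_lt_trans _ nT)// le_measure ?inE.
  move=> i j ij; apply/subsetPset => x [Ax nLx]; split => //; apply: contra_not nLx.
  by apply: subset_bigsetU.
rewrite (an _ mN aN) => /fine_cvgP[_ /cvgrPdist_le /(_ e e0)[k _ /(_ k (leqnn k))]].
rewrite /= sub0r normrN => ke; exists (L k); split => //.
  by rewrite /L; elim/big_ind : _ => // [B C BA CA|i _]; [rewrite subUset|case: (KP i)].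
have nL : n (A `\` L k) \is a fin_num.
  by rewrite ge0_fin_numE// (le_lt_trans _ nT)// le_measure ?inE.
by rewrite -(fineK nL) lee_fin (le_trans _ ke)// ler_norm.
Qed.

Lemma inner_regular_add (m n p : {measure set (borel T) -> \bar R}) :
  inner_regular m -> inner_regular n ->
  (forall A, measurable A -> p A = m A + n A) -> inner_regular p.
Proof.
move=> mK nK pE A mA e e0; have e20 : (0 < e / 2)%R by rewrite divr_gt0.
have [K [cK KA AK]] := mK _ mA _ e20; have [L [cL LA AL]] := nK _ mA _ e20.
exists (K `|` L); split; [exact: compactU|by rewrite subUset|].
have mK' := compact_borel cK; have mL' := compact_borel cL.
have mKL : measurable (A `\` (K `|` L) : set (borel T)).
  by apply: measurableD => //; exact: measurableU.
rewrite pE// [e in leRHS]splitr EFinD; apply: leeD.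
  apply: le_trans AK; rewrite le_measure ?inE//; first exact: measurableD.
  by move=> x [Ax]; rewrite not_orP => -[].
apply: le_trans AL; rewrite le_measure ?inE//; first exact: measurableD.
by move=> x [Ax]; rewrite not_orP => -[].
Qed.

End radon_measures.

Lemma measurable_borel_fun d (S : measurableType d) (T : ptopologicalType)
    (f : S -> T) :
  (forall U, open U -> measurable (f @^-1` U)) ->
  measurable_fun [set: S] (f : S -> borel T).
Proof.
move=> fU; apply: (@measurability _ _ S (borel T) setT f (@open T)) => // _ [U oU <-].
by rewrite setTI; exact: fU.
Qed.

(** The maps on the cone that are used below are continuous except at the
    vertex, where a constant value is imposed. *)
Lemma measurable_borel_const_off (S T : ptopologicalType) (U : set S) (f : S -> T) (t : T) :
  open U -> {in U, continuous f} -> (forall x, ~ U x -> f x = t) ->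
  measurable_fun [set: borel S] (f : borel S -> borel T).
Proof.
move=> oU cf ft; apply: measurable_borel_fun => V oV.
have oUV : open (U `&` f @^-1` V).
  rewrite openE => x [Ux Vx]; apply: filterI; first by apply: open_nbhs_nbhs; split.
  by apply: cf; rewrite ?inE//; apply: open_nbhs_nbhs; split.
have mU : measurable (~` U : set (borel S)) by apply: measurableC; exact: open_borel.
have [Vt|nVt] := pselect (V t).
  rewrite (_ : f @^-1` V = (U `&` f @^-1` V) `|` ~` U).
    by apply: measurableU => //; exact: open_borel.
  apply/seteqP; split => [x Vx|x [[]//|/ft fx]]; last by rewrite /= fx.
  by have [Ux|nUx] := pselect (U x); [left|right].
rewrite (_ : f @^-1` V = U `&` f @^-1` V); first exact: open_borel.
apply/seteqP; split => [x Vx|x []//]; split => //.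
by apply: contrapT => /ft fx; apply: nVt; rewrite -fx.
Qed.

Lemma continuous_borel_measurable (S T : ptopologicalType) (f : S -> T) :
  continuous f -> measurable_fun [set: borel S] (f : borel S -> borel T).
Proof.
move=> cf; apply: measurable_borel_fun => U oU; apply: open_borel.
by apply: open_comp => // x _; exact: cf.
Qed.

(** [pushforward] is a measure only along a proof of measurability; the
    existential form packs the measure with its change of variables. *)
Lemma exists_pushforward d d' (S : measurableType d) (T : measurableType d')
    (R : realType) (m : {measure set S -> \bar R}) (f : S -> T) :
  measurable_fun setT f ->
  exists n : {measure set T -> \bar R},
    (forall A, n A = m (f @^-1` A)) /\
    (forall g : T -> \bar R, measurable_fun setT g -> (forall y, 0 <= g y)%E ->
       (\int[n]_y g y = \int[m]_x g (f x))%E).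
Proof.
move=> mf.
refine (ex_intro _ (pushforward m f : {measure set T -> \bar R}) _).
Unshelve. 2: exact: mf.
by split => // g mg g0; rewrite ge0_integral_pushforward.
Qed.

Import HBNNSimple.

Lemma measure0_subU d (S : measurableType d) (R : realType)
    (m : {measure set S -> \bar R}) (A B D : set S) :
  measurable A -> measurable B -> measurable D -> D `<=` A `|` B ->
  (m A = 0 -> m B = 0 -> m D = 0)%E.
Proof.
move=> mA mB mD DAB A0 B0.
have mAB : measurable (A `|` B) by exact: measurableU.
apply/eqP; rewrite eq_le measure_ge0 andbT.
rewrite (@le_trans _ _ (m (A `|` B)))//; first by rewrite le_measure ?inE.
have -> : (0 = m A + m B)%E by rewrite A0 B0 adde0.
exact: measureU2.
Qed.

Lemma ae_ge0_le_integral_combination d (S : measurableType d) (R : realType)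
    (m : {measure set S -> \bar R}) (f g h : S -> \bar R) (k l : \bar R) :
  measurable_fun setT f -> measurable_fun setT g -> measurable_fun setT h ->
  (forall x, 0 <= f x)%E -> (forall x, 0 <= g x)%E -> (forall x, 0 <= h x)%E ->
  (0 <= k)%E -> (0 <= l)%E ->
  {ae m, forall x, [set: S] x -> h x <= k * f x + l * g x}%E ->
  (\int[m]_x h x <= k * \int[m]_x f x + l * \int[m]_x g x)%E.
Proof.
move=> mf mg mh f0 g0 h0 k0 l0 hfg.
have mkf : measurable_fun [set: S] (fun x => k * f x)%E by exact: measurable_funeM.
have mlg : measurable_fun [set: S] (fun x => l * g x)%E by exact: measurable_funeM.
have kf0 x : (0 <= k * f x)%E by rewrite mule_ge0.
have lg0 x : (0 <= l * g x)%E by rewrite mule_ge0.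
rewrite -!ge0_integralZl// -ge0_integralD//.
apply: ae_ge0_le_integral => //; last exact: emeasurable_funD.
by move=> x _; rewrite adde_ge0.
Qed.

(** The rule for integrals against a density holds by definition on indicators,
    then on simple functions by linearity, and passes to the limit by
    monotone convergence. *)
Lemma exists_density d (S : measurableType d) (R : realType)
    (m : {measure set S -> \bar R}) (f : S -> R) :
  measurable_fun setT f -> (forall x, 0 <= f x) ->
  exists n : {measure set S -> \bar R},
    (forall A, measurable A -> n A = \int[m]_(x in A) (f x)%:E)%E /\
    (forall g : S -> \bar R, measurable_fun setT g -> (forall y, 0 <= g y)%E ->
       (\int[n]_x g x = \int[m]_x (g x * (f x)%:E))%E).
Proof.
move=> /measurable_EFinP; set h := (EFin \o f) => mh f0.
have {f0}h0 x : (0 <= h x)%E by rewrite lee_fin f0.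
pose v A := (\int[m]_(x in A) h x)%E.
have v0 : (v set0 = 0)%E by rewrite /v integral_set0.
have vge0 A : (0 <= v A)%E by apply: integral_ge0 => x _.
have vs : semi_sigma_additive v by exact: semi_sigma_additive_nng_induced.
pose nu : {measure set S -> \bar R} := HB.pack v (isMeasure.Build _ _ _ v v0 vge0 vs).
exists nu; split => // g mg g0.
have simple (u : {nnsfun S >-> R}) :
    (\int[nu]_x (u x)%:E = \int[m]_x ((u x)%:E * h x))%E.
  rewrite integralT_nnsfun sintegralE.
  transitivity (\sum_(r \in range u)
      \int[m]_x (r%:E * (h \_ (u @^-1` [set r])) x))%E.
    apply: eq_fsbigr => r /[!inE] -[x _ <-].
    rewrite ge0_integralZl//; first by rewrite [nu _]integral_mkcond.
    - apply/(measurable_restrictT h) => //; exact: measurable_funTS.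
    - by move=> y _; rewrite patchE; case: ifP.
    - by rewrite lee_fin.
  rewrite -ge0_integral_fsum//.
  - apply: eq_integral => x _; rewrite (fsbigD1 (u x))//=; last by exists x.
      rewrite patchE mem_set//= fsbig1 ?adde0// => r [_ /eqP rf].
      by rewrite patchE memNset ?mule0//= => fr; rewrite fr eqxx in rf.
  - move=> r; apply: emeasurable_funM => //.
    apply/(measurable_restrictT h) => //; exact: measurable_funTS.
  - move=> r x _; rewrite patchE; case: ifP => [|_]; last by rewrite mule0.
    by rewrite inE => /= <-; rewrite mule_ge0// lee_fin.
pose f_ := nnsfun_approx measurableT mg.
have cf x : (f_ n x)%:E @[n --> \oo] --> g x by exact: cvg_nnsfun_approx.
transitivity (limn (fun n => \int[nu]_x (f_ n x)%:E))%E.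
  rewrite -monotone_convergence//.
  - by apply: eq_integral => y _; apply/esym/cvg_lim => //; exact: cf.
  - by move=> n; exact/measurable_EFinP.
  - by move=> n y _; rewrite lee_fin.
  - by move=> y _ i j ij; rewrite lee_fin; exact/lefP/nd_nnsfun_approx.
under eq_fun do rewrite simple.
rewrite -monotone_convergence//.
- apply: eq_integral => y _; apply/cvg_lim => //.
  by apply: cvgeZr => //; exact: cf.
- by move=> n; apply: emeasurable_funM => //; exact/measurable_EFinP.
- by move=> n y _; rewrite mule_ge0// lee_fin.
- move=> y _ i j ij; rewrite lee_wpmul2r// lee_fin; exact/lefP/nd_nnsfun_approx.
Qed.

Lemma measurable_preimage d d' (S : measurableType d) (T : measurableType d')
    (f : S -> T) (A : set T) :
  measurable_fun setT f -> measurable A -> measurable (f @^-1` A).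
Proof. by move=> mf mA; rewrite -[X in measurable X]setTI; exact: mf. Qed.

(** The compact sets can be chosen inside the open set [U] of full measure,
    where [f] is continuous. In the application [f] divides by a radius and
    [U] consists of the points away from the vertex. *)
Lemma inner_regular_pushforward (R : realType) (S T : ptopologicalType)
    (hS : hausdorff_space S) (hT : hausdorff_space T) (f : S -> T) (U : set S)
    (m : {measure set (borel S) -> \bar R})
    (n : {measure set (borel T) -> \bar R}) :
  measurable_fun [set: borel S] (f : borel S -> borel T) ->
  open U -> {in U, continuous f} -> m (~` U) = 0%E ->
  (forall A, n A = m (f @^-1` A)) -> inner_regular m -> inner_regular n.
Proof.
move=> mf oU cf mU nE mK A mA e e0.
have mfA := measurable_preimage mf mA.
have mU' : measurable (U : set (borel S)) by exact: open_borel.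
have [K [cK KA AK]] := mK _ (measurableI _ _ mfA mU') _ e0.
have cfK : compact (f @` K).
  apply: continuous_compact => //; apply: continuous_in_subspaceT => x.
  by rewrite inE => /KA[_ Ux]; apply: cf; rewrite inE.
exists (f @` K); split => //; first by move=> _ [x /KA[fAx _] <-].
have mfK := compact_borel hT cfK; have mK' := compact_borel hS cK.
have mD : measurable ((f @^-1` A `&` U) `\` K : set (borel S)).
  by apply: measurableD => //; exact: measurableI.
have mUc : measurable (~` U : set (borel S)) by exact: measurableC.
rewrite nE (@le_trans _ _ (m (((f @^-1` A `&` U) `\` K) `|` ~` U)))//.
  rewrite le_measure ?inE//; last 2 first.
  - exact: measurableU.
  - move=> x [Ax nfK]; have [Ux|] := pselect (U x); last by right.
    by left; split => // Kx; apply: nfK; exists x.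
  by apply: (measurable_preimage mf); exact: measurableD.
by rewrite (le_trans (measureU2 _ mD mUc))// [X in (_ + X)%E]mU adde0.
Qed.

Lemma borel_measure_eq (R : realType) (T : ptopologicalType)
    (m n : {measure set (borel T) -> \bar R}) :
  (forall U : set T, open U -> m U = n U) -> (m setT < +oo)%E ->
  forall A, measurable A -> m A = n A.
Proof.
move=> mn mT A mA.
apply: (@measure_unique _ R (borel T) (@open T) (fun=> setT)) => //.
- by move=> U V; exact: openI.
- by move=> _; exact: openT.
- by apply/seteqP; split => // x _; exists 0%N.
Qed.

(** * Extending a finitely additive set function to a Radon measure *)

(** Induction over compact sets: the complements in [K] of the sets with
    property [P] form a filter, and a cluster point of this filter would
    contradict the local hypothesis. *)
Lemma compact_ind (T : topologicalType) (K : set T) (P : set T -> Prop) :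
  compact K -> P set0 ->
  (forall A B, A `<=` B -> P B -> P A) ->
  (forall A B, P A -> P B -> P (A `|` B)) ->
  (forall x, K x -> exists2 V, nbhs x V & P V) -> P K.
Proof.
move=> cK P0 PS PU PK; apply: contrapT => nPK.
pose F : set_system T := [set S | P (K `\` S)].
have FF : ProperFilter F.
  apply: Build_ProperFilter_ex.
    move=> A FA; apply: contrapT => /forallNP A0; apply: nPK.
    by apply: PS FA => x Kx; split => // /A0.
  split.
  - by rewrite /F/= setDT.
  - by move=> A B FA FB; rewrite /F/= setDIr; exact: PU.
  - by move=> A B AB; apply: PS => x [Kx nBx]; split => // /AB.
have [|x [Kx clx]] := cK F FF; first by rewrite /F/= setDv.
have [V xV PV] := PK _ Kx.
have FV : F (K `\` V) by apply: PS PV => x' [K' nK']; apply: contrapT => nV; apply: nK'.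
by have [y [[_ nVy] Vy]] := clx _ _ FV xV.
Qed.

(** Let [b] be nonnegative and finitely additive on an algebra [Alg]. If the
    open sets of [Alg] that are inner approximable by compact sets of [Alg]
    form a base, then [b] restricted to these open sets extends to a Radon
    measure. Countable additivity costs nothing: a compact set that is covered
    by countably many open sets is covered by finitely many, so compactness
    turns finite subadditivity into countable subadditivity. *)
Section radon_extension.
Context {R : realType} {T : ptopologicalType}.
Hypothesis hT : hausdorff_space T.
Variables (Alg : set (set T)) (b : set T -> R).
Hypothesis AlgT : Alg setT.
Hypothesis AlgU : forall A B, Alg A -> Alg B -> Alg (A `|` B).
Hypothesis AlgD : forall A B, Alg A -> Alg B -> Alg (A `\` B).
Hypothesis b_ge0 : forall A, Alg A -> 0 <= b A.
Hypothesis bU : forall A B, Alg A -> Alg B -> A `&` B = set0 ->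
  b (A `|` B) = b A + b B.

Definition open_approx (G : set T) :=
  [/\ open G, Alg G & forall e : R, 0 < e -> exists K : set T,
    [/\ compact K, Alg K, K `<=` G & b (G `\` K) <= e]].

Hypothesis approxT : open_approx setT.
Hypothesis approx_base : forall (x : T) (U : set T), nbhs x U ->
  exists G, [/\ open_approx G, G x & G `<=` U].

Let Alg0 : Alg set0.
Proof. by rewrite -(setDv [set: T]); exact: AlgD. Qed.

Let b_split A B : Alg A -> Alg B -> B `<=` A -> b A = b B + b (A `\` B).
Proof.
move=> AA AB BA; rewrite -bU//; [by rewrite setDUK|exact: AlgD|].
by rewrite setDE setIC -setIA setICl setI0.
Qed.

Let b_le A B : Alg A -> Alg B -> B `<=` A -> b B <= b A.
Proof.
by move=> AA AB BA; rewrite (b_split AA AB BA) lerDl b_ge0//; exact: AlgD.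
Qed.

Let b0 : b set0 = 0.
Proof.
have := @bU set0 set0 Alg0 Alg0 (setI0 _); rewrite setU0 => /eqP.
by rewrite -subr_eq subrr eq_sym => /eqP.
Qed.

Let bU_le A B : Alg A -> Alg B -> b (A `|` B) <= b A + b B.
Proof.
move=> AA AB.
rewrite (_ : A `|` B = A `|` (B `\` A)); last first.
  by apply/seteqP; split => x [Ax|]; [left|have [] := pselect (A x); [left|right]|left|case; right].
rewrite bU//; first by rewrite lerD2l b_le//; exact: AlgD.
  exact: AlgD.
by rewrite setDE setICA setICr setI0.
Qed.

Let approx0 : open_approx set0.
Proof.
split => //; first exact: open0.
by move=> e e0; exists set0; split => //; [exact: compact0|rewrite setD0 b0 ltW].
Qed.

Let approxU G H : open_approx G -> open_approx H -> open_approx (G `|` H).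
Proof.
move=> [oG AG GK] [oH AH HK]; split; [exact: openU|exact: AlgU|] => e e0.
have e20 : 0 < e / 2 by rewrite divr_gt0.
have [K [cK AK KG bK]] := GK _ e20; have [L [cL AL LH bL]] := HK _ e20.
exists (K `|` L); split; [exact: compactU|exact: AlgU|exact: setUSS|].
rewrite (splitr e) (le_trans _ (lerD bK bL))// (le_trans _ (bU_le _ _))//;
  [|exact: AlgD|exact: AlgD].
apply: b_le; [by apply: AlgU; exact: AlgD|by apply: AlgD; exact: AlgU|].
by move=> x [[Gx|Hx] /not_orP[nK nL]]; [left|right].
Qed.

(* The approximable open sets are stable under finite unions, so they
   interpolate between a compact set and an open set around it. *)
Let compact_approx K U : compact K -> open U -> K `<=` U ->
  exists G, [/\ open_approx G, K `<=` G & G `<=` U].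
Proof.
move=> cK oU KU.
apply: (compact_ind cK (P := fun S => exists G, [/\ open_approx G, S `<=` G & G `<=` U])).
- by exists set0; split.
- by move=> A B AB [G [aG BG GU]]; exists G; split => //; exact: subset_trans BG.
- move=> A B [G [aG AG GU]] [H [aH BH HU]]; exists (G `|` H); split.
  + exact: approxU.
  + exact: setUSS.
  + by rewrite subUset.
- move=> x /KU Ux; have [|G [aG Gx GU]] := approx_base (U := U) (x := x).
    by apply: open_nbhs_nbhs; split.
  by exists G; [apply: open_nbhs_nbhs; split => //; case: aG|exists G; split].
Qed.

Local Open Scope ereal_scope.

Definition open_content (U : set T) : \bar R :=
  ereal_sup [set (b G)%:E | G in [set G | open_approx G /\ G `<=` U]].

Definition outer_content (E : set T) : \bar R :=
  ereal_inf [set open_content U | U in [set U | open U /\ E `<=` U]].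

Let oc_ge G U : open_approx G -> G `<=` U -> (b G)%:E <= open_content U.
Proof. by move=> aG GU; apply: ereal_sup_ubound; exists G. Qed.

Let oc_ge0 U : 0 <= open_content U.
Proof. by have := oc_ge approx0 (@sub0set _ U); rewrite b0. Qed.

Let oc_le U V : U `<=` V -> open_content U <= open_content V.
Proof.
move=> UV; apply: ge_ereal_sup => _ [G [aG GU] <-].
by apply: oc_ge => //; exact: subset_trans UV.
Qed.

Let oc_leT U : open_content U <= (b setT)%:E.
Proof.
apply: ge_ereal_sup => _ [G [aG GU] <-]; rewrite lee_fin b_le//.
by case: aG.
Qed.

Let oc_approx G : open_approx G -> open_content G = (b G)%:E.
Proof.
move=> aG; apply/eqP; rewrite eq_le oc_ge// andbT.
by apply: ge_ereal_sup => _ [H [aH HG] <-]; rewrite lee_fin b_le//; [case: aG|case: aH].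
Qed.

Let oc_fin U : open_content U \is a fin_num.
Proof. by rewrite ge0_fin_numE// (le_lt_trans (oc_leT _))// ltry. Qed.

(* A compact set [K] of almost full content in [G] is distributed over finitely
   many of the [U n] by [compact_ind]. *)
Let oc_sigma (U : (set T)^nat) : (forall n, open (U n)) ->
  open_content (\bigcup_n U n) <= \sum_(n <oo) open_content (U n).
Proof.
move=> oU; apply: ge_ereal_sup => _ [G [[oG AG GK] GU] <-].
apply/lee_addgt0Pr => e e0; have [K [cK AK KG bK]] := GK _ e0.
have [g [N [ag KgN]]] : exists (g : (set T)^nat) (N : nat),
    (forall n, open_approx (g n) /\ g n `<=` U n) /\ K `<=` \big[setU/set0]_(n < N) g n.
  apply: (compact_ind cK (P := fun S => exists (g : (set T)^nat) (N : nat),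
    (forall n, open_approx (g n) /\ g n `<=` U n) /\ S `<=` \big[setU/set0]_(n < N) g n)).
  - exists (fun=> set0), 0%N; split => [n|]; [by split|exact: sub0set].
  - by move=> A B AB [g [N [ag BN]]]; exists g, N; split => //; exact: (subset_trans AB).
  - move=> A B [g [N [ag AN]]] [h [M [ah BM]]].
    exists (fun n => g n `|` h n), (maxn N M); split.
      move=> n; have [? ?] := ag n; have [? ?] := ah n; split; first exact: approxU.
      by rewrite subUset.
    rewrite -bigcup_mkord in AN; rewrite -bigcup_mkord in BM; rewrite -(bigcup_mkord _ (fun n => g n `|` h n)).
    move=> x [/AN|/BM] [i /= iN gx]; exists i => /=.
    + by rewrite (leq_trans iN)// leq_maxl.
    + by left.
    + by rewrite (leq_trans iN)// leq_maxr.
    + by right.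
  - move=> x /KG/GU [n _ Ux]; have [|H [aH Hx HU]] := approx_base (U := U n) (x := x).
      by apply: open_nbhs_nbhs; split.
    exists H; first by apply: open_nbhs_nbhs; split => //; case: aH.
    exists (fun k => if k == n then H else set0), n.+1; split.
      by move=> k; case: ifPn => [/eqP->//|_]; split.
    rewrite -(bigcup_mkord _ (fun k => if k == n then H else set0)) => y Hy.
    by exists n => //=; rewrite eqxx.
have [AgN bgN] : Alg (\big[setU/set0]_(n < N) g n) /\
    (b (\big[setU/set0]_(n < N) g n) <= \sum_(n < N) b (g n))%R.
  elim: (N) => [|k [IH1 IH2]]; first by rewrite !big_ord0 b0.
  have [[_ ? _] _] := ag k; rewrite !big_ord_recr/=; split; first exact: AlgU.
  by rewrite (le_trans (bU_le _ _))// lerD2r.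
rewrite (b_split AG AK KG) EFinD leeD//.
rewrite (@le_trans _ _ (\sum_(n < N) b (g n))%:E)//.
  by rewrite lee_fin (le_trans _ bgN)// b_le.
rewrite -sumEFin (@le_trans _ _ (\sum_(n < N) open_content (U n)))//.
  by apply: lee_sum => n _; have [? ?] := ag n; exact: oc_ge.
rewrite -(big_mkord xpredT (fun n => open_content (U n))).
exact: nneseries_lim_ge.
Qed.

Let outer_open U : open U -> outer_content U = open_content U.
Proof.
move=> oU; apply/eqP; rewrite eq_le; apply/andP; split.
  by apply: ereal_inf_lbound; exists U => //; split.
by apply: le_ereal_inf_tmp => _ [V [oV UV] <-]; exact: oc_le.
Qed.

Let outer_ge0 E : 0 <= outer_content E.
Proof. by apply: le_ereal_inf_tmp => _ [V [oV UV] <-]. Qed.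

Let outer0 : outer_content set0 = 0.
Proof. by rewrite outer_open ?oc_approx ?b0//; exact: open0. Qed.

Let outer_le : {homo outer_content : A B / A `<=` B >-> A <= B}.
Proof.
move=> A B AB; apply: le_ereal_inf_tmp => _ [V [oV BV] <-].
by apply: ereal_inf_lbound; exists V => //; split => //; exact: subset_trans BV.
Qed.

Let outer_fin E : outer_content E \is a fin_num.
Proof.
rewrite ge0_fin_numE// (@le_lt_trans _ _ (outer_content setT))//; first exact: outer_le.
by rewrite outer_open ?(le_lt_trans (oc_leT _)) ?ltry//; exact: openT.
Qed.

Let outer_adherent E (e : R) : (0 < e)%R ->
  exists U, [/\ open U, E `<=` U & open_content U <= outer_content E + e%:E].
Proof.
move=> e0; have [_ [U [oU EU] <-] Ue] := lb_ereal_inf_adherent e0 (outer_fin E).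
by exists U; split => //; exact: ltW.
Qed.

Let outer_sigma : sigma_subadditive outer_content.
Proof.
move=> E; apply/lee_addgt0Pr => e e0.
have e2 n : (0 < e / (2 ^ n.+1)%:R)%R by rewrite divr_gt0// ltr0n expn_gt0.
have /choice[U UP] n := outer_adherent (E n) (e2 n).
rewrite (@le_trans _ _ (open_content (\bigcup_n U n)))//.
  rewrite -outer_open; last by apply: bigcup_open => n _; case: (UP n).
  by apply: outer_le; apply: subset_bigcup => n _; case: (UP n).
rewrite (le_trans (oc_sigma _))//; first by move=> n; case: (UP n).
rewrite (le_trans _ (epsilon_trick xpredT _ (ltW e0)))//.
by apply: lee_nneseries => // n _; case: (UP n).
Qed.

HB.instance Definition _ := isOuterMeasure.Build R T outer_content
  outer0 outer_ge0 outer_le outer_sigma.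

(* Split a test set at [U]: fill [V `&` U] from inside by a compact set [K];
   then [V `\` K] is open because [K] is closed, so its outer measure can be
   computed from inside as well, disjointly from [K]. *)
Let open_caratheodory U : open U -> outer_content.-caratheodory U.
Proof.
move=> oU; apply: le_caratheodory_measurable => X.
apply/lee_addgt0Pr => d d0; have [V [oV XV Vd]] := outer_adherent X d0.
rewrite (le_trans _ Vd)//.
rewrite (@le_trans _ _ (outer_content (V `&` U) + outer_content (V `&` ~` U)))//.
  by apply: leeD; apply: outer_le; exact: setSI.
have oVU : open (V `&` U) by exact: openI.
rewrite [outer_content (V `&` U)]outer_open//.
rewrite -leeBrDr; last exact: outer_fin.
apply: ge_ereal_sup => _ [G [[oG AG GK] GVU] <-].
rewrite leeBrDr; last exact: outer_fin.
apply/lee_addgt0Pr => e e0; have [K [cK AK KG bK]] := GK _ e0.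
have oVK : open (V `\` K).
  by rewrite setDE; apply: openI => //; apply: closed_openC; exact: compact_closed.
have KGU : K `<=` V `&` U by exact: subset_trans GVU.
rewrite (b_split AG AK KG) EFinD addeAC leeD ?lee_fin//.
rewrite (@le_trans _ _ ((b K)%:E + open_content (V `\` K)))//.
  rewrite leeD2l// -outer_open//; apply: outer_le => x [Vx nUx]; split => //.
  by move=> /KGU[].
rewrite addeC -leeBrDr//.
apply: ge_ereal_sup => _ [H [aH HVK] <-]; rewrite leeBrDr//.
have [L [aL KL LV]] := compact_approx cK oV (fun x Kx => (KGU x Kx).1).
have AH : Alg H by case: aH.
rewrite -EFinD -bU//; last first.
  by apply/seteqP; split => // x [/HVK[_ nK] /nK].
rewrite (@le_trans _ _ (b (H `|` L))%:E)//.
  rewrite lee_fin b_le//; [|exact: AlgU|exact: setUS].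
  by apply: AlgU => //; case: aL.
apply: oc_ge; first exact: approxU.
by rewrite subUset; split => // x /HVK[].
Qed.

Let borel_caratheodory (A : set (borel T)) : measurable A ->
  measurable (A : set (caratheodory_type outer_content)).
Proof.
apply: smallest_sub; first exact: sigma_algebra_measurable.
exact: open_caratheodory.
Qed.

(** By construction the extension is outer regular by open sets, so complements
    are inner regular by closed sets; intersecting with a compact set of almost
    full measure gives inner regularity by compact sets. *)
Lemma radon_extension :
  exists2 m : {finite_measure set (borel T) -> \bar R},
    Mplus T R m & forall G, open_approx G -> m G = (b G)%:E.
Proof.
have msig : semi_sigma_additive (outer_content : set (borel T) -> \bar R).
  move=> F mF tF mUF.
  pose oc : {outer_measure set T -> \bar R} := outer_content.
  pose mc : {measure set (caratheodory_type oc) -> \bar R} := oc.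
  apply: (@measure_semi_sigma_additive _ _ _ mc) => //.
  - by move=> n; exact: borel_caratheodory.
  - exact: borel_caratheodory.
pose m : {measure set (borel T) -> \bar R} :=
  HB.pack (outer_content : set (borel T) -> \bar R)
    (isMeasure.Build _ (borel T) _ outer_content outer0 outer_ge0 msig).
have mE A : m A = outer_content A by [].
have mT : m setT < +oo by rewrite mE -ge0_fin_numE.
have mK : inner_regular m.
  move=> A mA e e0; have e20 : (0 < e / 2)%R by rewrite divr_gt0.
  have mAc := measurableC mA.
  have [U [oU AU Ue]] := outer_adherent (~` A) e20.
  have [_ _ /(_ _ e20)[K [cK AK _ Ke]]] := approxT.
  have cKU : compact (K `&` ~` U).
    by apply: compact_closedI => //; apply: open_closedC.
  exists (K `&` ~` U); split => //; first by move=> x [_ nU]; apply: contrapT => /AU.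
  have mU := open_borel oU; have mK := compact_borel hT cK.
  rewrite (@le_trans _ _ (m ((U `\` ~` A) `|` (setT `\` K))))//.
    rewrite le_measure ?inE//.
    - by apply: measurableD => //; apply: compact_borel.
    - by apply: measurableU; exact: measurableD.
    - by move=> x [Ax] /not_andP[nK|/contrapT Ux]; [right; split|left; split => // /(_ Ax)].
  rewrite (le_trans (measureU2 _ _ _))//; try exact: measurableD.
  rewrite (splitr e) EFinD leeD//.
    rewrite measureD//; last by rewrite -ge0_fin_numE ?mE.
    rewrite setIidr// leeBlDl.
    have mUE : m U = open_content U by exact: outer_open.
    by move: Ue; rewrite -mUE addeC.
    exact: outer_fin.
  have oKc : open (setT `\` K).
    by rewrite setTD; apply: closed_openC; exact: compact_closed.
  change (outer_content (setT `\` K) <= (e / 2)%:E); rewrite (outer_open oKc).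
  apply: ge_ereal_sup => _ [G [[oG AG _] GK] <-].
  rewrite (le_trans _ (_ : (b (setT `\` K))%:E <= _)) ?lee_fin// b_le//.
  exact: AlgD.
have [n nM nE] := exists_Mplus hT mT mK.
exists n => // G aG; have oG : open G by case: aG.
by rewrite nE ?mE ?outer_open ?oc_approx//; exact: open_borel.
Qed.

End radon_extension.

(** * Gluing two Radon measures along a common marginal *)

Lemma cluster_continuous (S T : topologicalType) (f : S -> T) (x y : S) :
  {for x, continuous f} -> {for y, continuous f} ->
  cluster (nbhs x) y -> cluster (nbhs (f x)) (f y).
Proof.
move=> fx fy xy A B /fx xA /fy yB.
by have [z [Az Bz]] := xy _ _ xA yB; exists (f z).
Qed.

Lemma hausdorff_prod (S T : ptopologicalType) :
  hausdorff_space S -> hausdorff_space T -> hausdorff_space (S * T)%type.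
Proof.
move=> hS hT [x1 x2] [y1 y2] xy; congr pair.
  apply: hS; apply: (cluster_continuous _ _ xy (f := fst)); exact: cvg_fst.
apply: hT; apply: (cluster_continuous _ _ xy (f := snd)); exact: cvg_snd.
Qed.

Lemma open_rectangle (S T : topologicalType) (V : set S) (W : set T) :
  open V -> open W -> open (V `*` W).
Proof.
move=> oV oW; have -> : V `*` W = (@fst S T) @^-1` V `&` (@snd S T) @^-1` W.
  by apply/seteqP; split.
by apply: openI; apply: open_comp => // x _; [exact: cvg_fst|exact: cvg_snd].
Qed.

(** An ultrafilter contains the preimage of a set or of its complement, so a
    cluster point of the image filter is already a limit. *)
Lemma ultra_bounded_cvg (R : realType) (I : Type) (G : set_system I)
    (f : I -> R) (M : R) :
  UltraFilter G -> (\forall i \near G, 0 <= f i <= M) -> cvg (f i @[i --> G]).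
Proof.
move=> GU fM.
have [l [_ fl]] : `[0, M]%classic `&` cluster (f i @[i --> G]) !=set0.
  apply: segment_compact.
  by rewrite /nbhs/=; apply: filterS fM => i; rewrite /= in_itv.
apply/cvg_ex; exists l => V lV.
have [//|GnV] := in_ultra_setVsetC (f @^-1` V) GU.
by have [z [nVz Vz]] := fl (~` V) V GnV lV.
Qed.

(** Disintegration along [q1] and [q2] would require a lifting, as compact
    subsets of the spaces need not be metrizable. Instead [a1] and [a2] are
    glued independently on each cell of a finite partition of [Z]. Refining the
    partition along an ultrafilter gives a finitely additive limit that no
    longer charges pairs with different images, and the regularity of the
    marginals makes it extend to a Radon measure. *)
Section gluing.
Context {R : realType} {Y1 Y2 Z : ptopologicalType}.
Hypotheses (hY1 : hausdorff_space Y1) (hY2 : hausdorff_space Y2).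
Hypothesis hZ : hausdorff_space Z.
Variables (a1 : {finite_measure set (borel Y1) -> \bar R}).
Variables (a2 : {finite_measure set (borel Y2) -> \bar R}).
Variables (q1 : Y1 -> Z) (q2 : Y2 -> Z).
Hypothesis mq1 : measurable_fun [set: borel Y1] (q1 : borel Y1 -> borel Z).
Hypothesis mq2 : measurable_fun [set: borel Y2] (q2 : borel Y2 -> borel Z).
Hypothesis a12 : forall B : set (borel Z), measurable B ->
  a1 (q1 @^-1` B) = a2 (q2 @^-1` B).

Local Notation prodY := (borel Y1 * borel Y2)%type.

Let mpre1 (B : set (borel Z)) : measurable B -> measurable (q1 @^-1` B : set (borel Y1)).
Proof. exact: (measurable_preimage mq1). Qed.

Let mpre2 (B : set (borel Z)) : measurable B -> measurable (q2 @^-1` B : set (borel Y2)).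
Proof. exact: (measurable_preimage mq2). Qed.

Definition cell (A : set Z) : set prodY := (q1 @^-1` A) `*` (q2 @^-1` A).

(** The sets in [s] generate a finite partition of [A]. On each cell of the
    partition the two restrictions are multiplied and renormalised by the
    common mass of the cell; a null cell contributes 0 by the convention
    [x / 0 = 0], which is the right value as both restrictions vanish there. *)
Fixpoint glue (s : seq (set Z)) (A : set Z) (E : set prodY) : R :=
  if s is B :: s' then glue s' (A `&` B) E + glue s' (A `\` B) E
  else fine ((a1 \x a2)%E (E `&` cell A)) / fine (a1 (q1 @^-1` A)).

Let all_borel (s : seq (set Z)) :=
  forall B : set (borel Z), B \in (s : seq (set (borel Z))) -> measurable B.

Let prod_fin (E : set prodY) : measurable E -> (a1 \x a2)%E E \is a fin_num.
Proof.
move=> mE; rewrite ge0_fin_numE ?measure_ge0//.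
rewrite (@le_lt_trans _ _ ((a1 \x a2)%E (setT `*` setT)))//.
  by rewrite le_measure ?inE//; exact: measurableX.
rewrite product_measure1E// -ge0_fin_numE ?mule_ge0//.
by rewrite fin_numM// fin_num_measure.
Qed.

Let mcell (A : set (borel Z)) : measurable A -> measurable (cell A).
Proof. by move=> mA; apply: measurableX; [exact: mpre1|exact: mpre2]. Qed.

Lemma glue_ge0 s A E : 0 <= glue s A E.
Proof.
elim: s A => [|B s IH] A /=; last by rewrite addr_ge0.
by rewrite divr_ge0// fine_ge0.
Qed.

Lemma glueU s (A : set (borel Z)) E F : all_borel s -> measurable A ->
  measurable E -> measurable F -> E `&` F = set0 ->
  glue s A (E `|` F) = glue s A E + glue s A F.
Proof.
move=> + + mE mF EF; elim: s A => [|B s IH] A sB mA /=.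
  have mc := mcell mA.
  have mEc := measurableI _ _ mE mc; have mFc := measurableI _ _ mF mc.
  rewrite setIUl measureU//; last by rewrite setIACA EF set0I.
  by rewrite fineD ?mulrDl//; exact: prod_fin.
have mB : measurable (B : set (borel Z)) by apply: sB; rewrite mem_head.
have sB' : all_borel s by move=> C Cs; apply: sB; rewrite inE Cs orbT.
have mAB := measurableI _ _ mA mB; have mADB := measurableD mA mB.
by rewrite (IH (A `&` B))// (IH (A `\` B))// addrACA.
Qed.

Lemma glue_fst s (A : set (borel Z)) (E : set (borel Y1)) :
  all_borel s -> measurable A -> measurable E ->
  glue s A (E `*` setT) = fine (a1 (E `&` q1 @^-1` A)).
Proof.
move=> + + mE; elim: s A => [|B s IH] A sB mA /=.
  have mA1 := mpre1 mA; have mA2 := mpre2 mA.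
  have mEA := measurableI _ _ mE mA1.
  have -> : (a1 \x a2)%E (E `*` setT `&` cell A) =
      (a1 (E `&` q1 @^-1` A) * a1 (q1 @^-1` A))%E.
    by rewrite /cell -setXI setTI product_measure1E// a12.
  rewrite fineM ?fin_num_measure//.
  have [A0|A0] := eqVneq (fine (a1 (q1 @^-1` A))) 0; last by rewrite mulfK.
  rewrite A0 invr0 mulr0; apply/esym/eqP; rewrite eq_le fine_ge0// andbT.
  by rewrite -A0 fine_le ?fin_num_measure// le_measure ?inE.
have mB : measurable (B : set (borel Z)) by apply: sB; rewrite mem_head.
have sB' : all_borel s by move=> C Cs; apply: sB; rewrite inE Cs orbT.
have mAB := measurableI _ _ mA mB; have mADB := measurableD mA mB.
have mE1 := measurableI _ _ mE (mpre1 mAB).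
have mE2 := measurableI _ _ mE (mpre1 mADB).
rewrite !IH// -fineD ?fin_num_measure// -measureU//.
  congr (fine (a1 _)); apply/seteqP; split => [x [[Ex [Ax _]]|[Ex [Ax _]]]//|x [Ex Ax]].
  by have [] := pselect (B (q1 x)); [left|right].
by apply/seteqP; split => // x [[_ [_ Bx]] [_ [_ /(_ Bx)]]].
Qed.

Lemma glue_snd s (A : set (borel Z)) (E : set (borel Y2)) :
  all_borel s -> measurable A -> measurable E ->
  glue s A (setT `*` E) = fine (a2 (E `&` q2 @^-1` A)).
Proof.
move=> + + mE; elim: s A => [|B s IH] A sB mA /=.
  have mA1 := mpre1 mA; have mA2 := mpre2 mA.
  have mEA := measurableI _ _ mE mA2.
  have -> : (a1 \x a2)%E (setT `*` E `&` cell A) =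
      (a2 (q2 @^-1` A) * a2 (E `&` q2 @^-1` A))%E.
    by rewrite /cell -setXI setTI product_measure1E// -a12.
  rewrite a12// fineM ?fin_num_measure//.
  have [A0|A0] := eqVneq (fine (a2 (q2 @^-1` A))) 0; last by rewrite mulrAC mulfV// mul1r.
  rewrite A0 invr0 mulr0; apply/esym/eqP; rewrite eq_le fine_ge0// andbT.
  by rewrite -A0 fine_le ?fin_num_measure// le_measure ?inE.
have mB : measurable (B : set (borel Z)) by apply: sB; rewrite mem_head.
have sB' : all_borel s by move=> C Cs; apply: sB; rewrite inE Cs orbT.
have mAB := measurableI _ _ mA mB; have mADB := measurableD mA mB.
have mE1 := measurableI _ _ mE (mpre2 mAB).
have mE2 := measurableI _ _ mE (mpre2 mADB).
rewrite !IH// -fineD ?fin_num_measure// -measureU//.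
  congr (fine (a2 _)); apply/seteqP; split => [x [[Ex [Ax _]]|[Ex [Ax _]]]//|x [Ex Ax]].
  by have [] := pselect (B (q2 x)); [left|right].
by apply/seteqP; split => // x [[_ [_ Bx]] [_ [_ /(_ Bx)]]].
Qed.

Lemma glue_separated s (V W A : set Z) :
  A `&` V = set0 \/ A `&` W = set0 ->
  glue s A ((q1 @^-1` V) `*` (q2 @^-1` W)) = 0.
Proof.
elim: s A => [|B s IH] A AVW /=.
  rewrite (_ : _ `&` cell A = set0) ?measure0 ?mul0r//.
  rewrite -subset0 => -[x y] /= [[Vx Wy] [Ax Ay]].
  by case: AVW => /seteqP[AVW _]; [apply: (AVW (q1 x))|apply: (AVW (q2 y))].
rewrite !IH ?addr0//; case: AVW => AVW; [left|right|left|right];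
  by rewrite -subset0 -AVW => x [[]].
Qed.

(** Once [V] belongs to the partition, every cell is contained in [V] or
    disjoint from it, hence misses [W] or [V]. *)
Lemma glue_disjoint s (V W A : set Z) : V \in s -> V `&` W = set0 ->
  glue s A ((q1 @^-1` V) `*` (q2 @^-1` W)) = 0.
Proof.
move=> + VW; elim: s A => // B s IH A; rewrite inE => /predU1P[<-|Vs] /=.
  rewrite !glue_separated ?addr0//; first by left; rewrite setDE -setIA setICl setI0.
  by right; rewrite -setIA VW setI0.
by rewrite !IH ?addr0.
Qed.

(** Only lists of Borel sets matter; finer partitions are larger lists. *)
Definition refinement : set_system (seq (set Z)) :=
  [set S | exists2 s0, all_borel s0 &
     forall s, all_borel s -> {subset s0 <= s} -> S s].

Let refinement_filter : ProperFilter refinement.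
Proof.
apply: Build_ProperFilter_ex.
  by move=> S [s0 bs0 Ss0]; exists s0; exact: Ss0.
split.
- by exists [::].
- move=> P Q [s bs Ps] [t bt Qt]; exists (s ++ t).
    by move=> B; rewrite mem_cat => /orP[/bs|/bt].
  move=> u bu stu; split; [apply: Ps => //|apply: Qt => //] => B Bs;
    by apply: stu; rewrite mem_cat Bs ?orbT.
- by move=> P Q PQ [s bs Ps]; exists s => // t bt st; apply: PQ; exact: Ps.
Qed.

Let G := projT1 (cid (ultraFilterLemma refinement_filter)).

Let GU : UltraFilter G.
Proof. by rewrite /G; case: cid => ? []. Qed.

#[local] Existing Instance GU.

Let refG : refinement `<=` G.
Proof. by rewrite /G; case: cid => ? []. Qed.

Let near_borel : \forall s \near G, all_borel s.
Proof. by apply: refG; exists [::]. Qed.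

Definition glued (E : set prodY) : R := lim (glue s setT E @[s --> G]).

Let mT : measurable [set: borel Z] := measurableT.

Let glue_le s E : all_borel s -> measurable E ->
  glue s setT E <= fine (a1 setT).
Proof.
move=> bs mE; have mEc := measurableC mE.
have := @glueU s setT E (~` E) bs mT mE mEc (setICr _).
rewrite setUCr (_ : [set: prodY] = setT `*` setT); last first.
  by apply/seteqP; split => -[].
rewrite glue_fst// setTI preimage_setT => ->.
by rewrite lerDl glue_ge0.
Qed.

Let glue_cvg E : measurable E -> glue s setT E @[s --> G] --> glued E.
Proof.
move=> mE; apply: (ultra_bounded_cvg (M := fine (a1 setT))).
by apply: filterS near_borel => s bs; rewrite glue_ge0 glue_le.
Qed.

Let glued_ge0 E : measurable E -> 0 <= glued E.
Proof.
move=> mE; apply: limr_ge; first exact: (cvgP _ (glue_cvg mE)).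
by apply: filterE => s; exact: glue_ge0.
Qed.

Let gluedU E F : measurable E -> measurable F -> E `&` F = set0 ->
  glued (E `|` F) = glued E + glued F.
Proof.
move=> mE mF EF; apply: cvg_lim => //.
apply: cvg_trans (cvgD (glue_cvg mE) (glue_cvg mF)).
apply: near_eq_cvg; apply: filterS near_borel => s bs.
by rewrite /= glueU.
Qed.

(* The marginals do not depend on the partition, and disjoint images are
   separated by all fine enough partitions. *)
Let glued_near E c : (\forall s \near G, glue s setT E = c) -> glued E = c.
Proof.
move=> Ec; apply: cvg_lim => //; apply: cvg_near_cst.
exact: Ec.
Qed.

Let glued_fst (E : set (borel Y1)) : measurable E -> glued (E `*` setT) = fine (a1 E).
Proof.
move=> mE; apply: glued_near; apply: filterS near_borel => s bs.
by rewrite glue_fst// preimage_setT setIT.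
Qed.

Let glued_snd (E : set (borel Y2)) : measurable E -> glued (setT `*` E) = fine (a2 E).
Proof.
move=> mE; apply: glued_near; apply: filterS near_borel => s bs.
by rewrite glue_snd// preimage_setT setIT.
Qed.

Let glued_disjoint (V W : set Z) : measurable (V : set (borel Z)) -> V `&` W = set0 ->
  glued ((q1 @^-1` V) `*` (q2 @^-1` W)) = 0.
Proof.
move=> mV VW; apply: glued_near; apply: refG; exists [:: V].
  by move=> B; rewrite inE => /eqP ->.
by move=> s _ sV; apply: glue_disjoint => //; apply: sV; rewrite mem_head.
Qed.

Hypotheses (K1 : inner_regular a1) (K2 : inner_regular a2).

Let glued_le E F : measurable E -> measurable F -> E `<=` F -> glued E <= glued F.
Proof.
move=> mE mF EF; rewrite -(setDUK EF) gluedU//; last 2 first.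
- exact: measurableD.
- by rewrite setDE setICA setICr setI0.
by rewrite lerDl glued_ge0//; exact: measurableD.
Qed.

Let prodY_measurable : set (set (Y1 * Y2)) := (measurable : set (set prodY)).

(* A rectangle minus a compact subrectangle is covered by two strips, whose
   content is computed from the marginals. *)
Let approxX (V : set Y1) (W : set Y2) : open V -> open W ->
  open_approx prodY_measurable glued (V `*` W).
Proof.
move=> oV oW; have mV := @open_borel _ V oV; have mW := @open_borel _ W oW.
split; [exact: open_rectangle|exact: measurableX|] => e e0.
have e20 : 0 < e / 2 by rewrite divr_gt0.
have [K [cK KV VK]] := K1 mV e20; have [L [cL LW WL]] := K2 mW e20.
have mK := compact_borel hY1 cK; have mL := compact_borel hY2 cL.
exists (K `*` L); split.
- exact: compact_setX.
- exact: measurableX.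
- by move=> [x y] [/KV ? /LW ?].
have mVK := measurableD mV mK; have mWL := measurableD mW mL.
have mP := measurableX mVK (@measurableT _ (borel Y2)).
have mQ := measurableX (@measurableT _ (borel Y1)) mWL.
rewrite (@le_trans _ _ (glued (((V `\` K) `*` setT) `|` ((setT `*` (W `\` L)) `\` ((V `\` K) `*` setT)))))//.
  apply: glued_le.
  - by apply: measurableD; exact: measurableX.
  - by apply: measurableU => //; exact: measurableD.
  move=> [x y] /= [[Vx Wy] /not_andP nKL].
  have [Kx|nKx] := pselect (K x); last by left.
  by right; split; [split => //; split => //; case: nKL|move=> [[]]].
rewrite gluedU//; [|exact: measurableD|by rewrite setDE setICA setICr setI0].
rewrite (splitr e) lerD//.
  rewrite glued_fst// -lee_fin fineK//; exact: fin_num_measure.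
rewrite (@le_trans _ _ (glued (setT `*` (W `\` L))))//.
  by apply: glued_le => //; exact: measurableD.
rewrite glued_snd// -lee_fin fineK//; exact: fin_num_measure.
Qed.

Variables (U1 : set Y1) (U2 : set Y2).
Hypotheses (oU1 : open U1) (oU2 : open U2).
Hypotheses (cq1 : {in U1, continuous q1}) (cq2 : {in U2, continuous q2}).

(** Outside the fibre product, distinct images have disjoint neighbourhoods, so
    every point has a rectangular neighbourhood of content 0; compactness and
    inner regularity make the whole open set null. The marginals are identified
    on open sets, which suffices. *)
Theorem radon_gluing :
  exists m : {finite_measure set (borel (Y1 * Y2)%type) -> \bar R},
  [/\ Mplus (Y1 * Y2)%type R m,
    forall A : set (borel Y1), measurable A -> m (fst @^-1` A) = a1 A,
    forall A : set (borel Y2), measurable A -> m (snd @^-1` A) = a2 A &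
    m.-negligible [set y : borel (Y1 * Y2)%type | [/\ U1 y.1, U2 y.2 & q1 y.1 <> q2 y.2]]].
Proof.
have hY : hausdorff_space (Y1 * Y2)%type by exact: hausdorff_prod.
have [] := @radon_extension R (Y1 * Y2)%type hY prodY_measurable glued.
- exact: measurableT.
- by move=> A B; exact: measurableU.
- by move=> A B; exact: measurableD.
- exact: glued_ge0.
- exact: gluedU.
- rewrite (_ : [set: Y1 * Y2] = setT `*` setT); last by apply/seteqP; split => -[].
  by apply: approxX; exact: openT.
- move=> [x y] U [[V W] /= [xV yW] VWU].
  exists (interior V `*` interior W); split.
  + by apply: approxX; exact: open_interior.
  + by split.
  + by move=> [v w] [/= /interior_subset Vv /interior_subset Ww]; exact: VWU.
move=> m mM mE; exists m.
have mfT : (m setT < +oo)%E by have := fin_num_measure m setT measurableT; rewrite ge0_fin_numE.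
have mfst : measurable_fun [set: borel (Y1 * Y2)%type] (fst : borel (Y1 * Y2)%type -> borel Y1).
  by apply: (continuous_borel_measurable (S := (Y1 * Y2)%type)) => x; exact: cvg_fst.
have msnd : measurable_fun [set: borel (Y1 * Y2)%type] (snd : borel (Y1 * Y2)%type -> borel Y2).
  by apply: (continuous_borel_measurable (S := (Y1 * Y2)%type)) => x; exact: cvg_snd.
split => //.
- move=> A mA; have [n [nE _]] := exists_pushforward m mfst.
  rewrite -nE; apply: borel_measure_eq => //; last by rewrite nE preimage_setT.
  move=> V oV; rewrite nE; transitivity ((glued (V `*` setT))%:E).
    by rewrite -(mE _ (approxX oV openT)) setXT.
  by rewrite glued_fst ?fineK ?fin_num_measure//; exact: open_borel.
- move=> A mA; have [n [nE _]] := exists_pushforward m msnd.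
  rewrite -nE; apply: borel_measure_eq => //; last by rewrite nE preimage_setT.
  move=> V oV; rewrite nE; transitivity ((glued (setT `*` V))%:E).
    by rewrite -(mE _ (approxX openT oV)) setTX.
  by rewrite glued_snd ?fineK ?fin_num_measure//; exact: open_borel.
pose D := [set y : (Y1 * Y2)%type | [/\ U1 y.1, U2 y.2 & q1 y.1 <> q2 y.2]].
have Eloc y : D y -> exists V W,
    [/\ open V, open W, V y.1 /\ W y.2, V `*` W `<=` D & glued (V `*` W) = 0].
  move=> [U1y U2y qy].
  have nq : q1 y.1 != q2 y.2 by apply/eqP.
  have := hZ; rewrite open_hausdorff => /(_ _ _ nq).
  move=> [[A B] [/= /set_mem Ay /set_mem By] [oA oB /eqP AB]].
  have mA := open_borel oA; have mB := open_borel oB.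
  have nV : nbhs y.1 (U1 `&` q1 @^-1` A).
    apply: filterI; first by apply: open_nbhs_nbhs; split.
    by apply: cq1; rewrite ?inE//; apply: open_nbhs_nbhs; split.
  have nW : nbhs y.2 (U2 `&` q2 @^-1` B).
    apply: filterI; first by apply: open_nbhs_nbhs; split.
    by apply: cq2; rewrite ?inE//; apply: open_nbhs_nbhs; split.
  have oV := @open_interior Y1 (U1 `&` q1 @^-1` A).
  have oW := @open_interior Y2 (U2 `&` q2 @^-1` B).
  have mV := @open_borel Y1 _ oV; have mW := @open_borel Y2 _ oW.
  exists (interior (U1 `&` q1 @^-1` A)), (interior (U2 `&` q2 @^-1` B)); split => //.
    move=> [v w] [/= /interior_subset[U1v Av] /interior_subset[U2w Bw]].
    split => //= vw; have : (A `&` B) (q1 v) by split => //; rewrite vw.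
    by rewrite AB.
  apply/eqP; rewrite eq_le glued_ge0 ?andbT; last exact: measurableX.
  rewrite -(glued_disjoint mA AB) glued_le//.
  - exact: measurableX.
  - by apply: measurableX; [exact: mpre1|exact: mpre2].
  - by move=> [v w] [/= /interior_subset[_ Vv] /interior_subset[_ Ww]].
have mE0 K : compact K -> K `<=` D -> m K = 0%E.
  move=> cK KE.
  have [G' [oG' KG' mG']] : exists G', [/\ open G', K `<=` G' & m G' = 0%E].
    apply: (compact_ind cK (P := fun S => exists G', [/\ open G', S `<=` G' & m G' = 0%E])).
    - by exists set0; split => //; exact: open0.
    - by move=> A B AB [G' [oG' BG' mG']]; exists G'; split => // x /AB/BG'.
    - move=> A B [V [oV AV mV]] [W [oW BW mW]]; exists (V `|` W); split.
      + exact: openU.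
      + exact: setUSS.
      + apply/eqP; rewrite eq_le measure_ge0 andbT.
        have -> : (0 = m V + m W)%E by rewrite mV mW adde0.
        by apply: measureU2; exact: open_borel.
    - move=> y /KE /Eloc[V [W [oV oW [Vy Wy] VWE VW0]]]; exists (V `*` W).
        by apply: open_nbhs_nbhs; split => //; exact: open_rectangle.
      exists (V `*` W); split => //; first exact: open_rectangle.
      by rewrite mE ?VW0//; exact: approxX.
  apply/eqP; rewrite eq_le measure_ge0 andbT -mG' le_measure ?inE//.
  - exact: (compact_borel hY).
  - exact: open_borel.
have oE : open D.
  rewrite openE => y /Eloc[V [W [oV oW [Vy Wy] VWE _]]].
  apply: (filterS VWE); apply: open_nbhs_nbhs; split => //; exact: open_rectangle.
have mE' := open_borel oE.
exists D; split => //; apply/eqP; rewrite eq_le measure_ge0 andbT.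
apply/lee_addgt0Pr => e e0; rewrite add0e.
have [K [cK KE EK]] := Mplus_inner_regular hY mM mE' e0.
have mK := compact_borel hY cK.
have -> : e%:E = (m K + e%:E)%E by rewrite mE0// add0e.
rewrite -(setDUK KE) (le_trans (measureU2 _ _ _))//; first exact: measurableD.
by rewrite leeD2l.
Qed.

End gluing.

(** * The topology of the cone *)

Lemma continuous_measurable_real (R : realType) (T : ptopologicalType) (f : T -> R) :
  continuous f -> measurable_fun [set: borel T] (f : borel T -> R).
Proof.
move=> cf; apply: (measurability _ (RGenOpens.measurableE R)).
move=> _ [_ [a [b ->] <-]]; rewrite setTI; apply: open_borel.
by apply: open_comp => // x _; exact: cf.
Qed.

Lemma lsc_measurable (R : realType) (T : ptopologicalType) (f : T -> \bar R) :
  lower_semicontinuous f -> measurable_fun [set: borel T] (f : borel T -> \bar R).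
Proof.
move=> /lower_semicontinuousP scif.
apply: (measurability _ (ErealGenOInfty.measurableE R)).
move=> /= _ [_ [a ->]] <-; rewrite setTI; apply: open_borel.
by rewrite preimage_itvoy; exact: scif.
Qed.

Section cone_topology.
Context {R : realType} {X : ptopologicalType}.
Local Notation C := (cone X R).

(** [cpt] with a real radius; the absolute value only serves to make the
    function total, and keeps it continuous. *)
Definition cptr (x : X) (r : R) : C := cpt x (`|r|%:nng).

Lemma cradius_ge0 (z : C) : 0 <= cradius z.
Proof. by rewrite /cradius. Qed.

Lemma cradius_cptr x r : cradius (cptr x r) = `|r|.
Proof. by rewrite /cptr cradiusE. Qed.

Lemma cbase_cptr x r : r != 0 -> cbase (cptr x r) = x.
Proof. by move=> r0; rewrite /cptr cbaseE//= normr_eq0. Qed.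

Lemma cptr_cone (z : C) : cptr (cbase z) (cradius z) = z.
Proof.
rewrite -[RHS]cpt_repr /cptr; congr cpt; apply/val_inj => /=.
by rewrite ger0_norm ?cradius_ge0.
Qed.

Lemma cptr0 x : cptr x 0 = vertex.
Proof.
by rewrite -(vertexE x) /cptr; congr cpt; apply/val_inj; rewrite /= normr0.
Qed.

Lemma cradius_vertex : cradius (vertex : C) = 0.
Proof. by rewrite /vertex cradiusE. Qed.

Lemma cradius0_vertex (z : C) : cradius z = 0 -> z = vertex.
Proof. by move=> z0; rewrite -(cptr_cone z) z0 cptr0. Qed.

Lemma cone_eq (z w : C) : cradius z = cradius w ->
  (cradius z != 0 -> cbase z = cbase w) -> z = w.
Proof.
move=> zw; have [z0 _|z0 /(_ isT) bzw] := eqVneq (cradius z) 0.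
  by rewrite [LHS]cradius0_vertex// [RHS]cradius0_vertex// -zw.
by rewrite -(cptr_cone z) -(cptr_cone w) zw bzw.
Qed.

(** Convergence in the cone is convergence of the radii, together with that of
    the base points when the limit is not the vertex. *)
Lemma cone_cvg (T : Type) (F : set_system T) (f : T -> C) (z : C) : Filter F ->
  cradius (f x) @[x --> F] --> cradius z ->
  (cradius z != 0 -> cbase (f x) @[x --> F] --> cbase z) ->
  f x @[x --> F] --> z.
Proof.
move=> FF rf bf A; rewrite {1}/nbhs /= /cone_nbhs; case: ifPn => z0.
  move=> [e /= e0 eA]; rewrite (eqP z0) in rf.
  have : \forall x \near F, cradius (f x) < e by apply: (rf [set r | r < e]); exact: lt_nbhsl.
  by apply: filterS => x xe; apply: eA.
move=> [[V W] [/= zV zW] VWA].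
case: zW => B [[Q oQ QB] zB BW]; rewrite -{}QB in zB BW.
have nV : \forall x \near F, V (cbase (f x)) by exact: (bf z0).
have nO : \forall x \near F, Q (cradius (f x)).
  by apply: rf; apply: open_nbhs_nbhs; split.
apply: filterS2 nV nO => x Vx Qx /=.
rewrite -[f x]cpt_repr; apply: (VWA (cbase (f x), (crepr (f x)).2)).
by split => //=; exact: BW.
Qed.

Lemma cradius_continuous : continuous (cradius : C -> R).
Proof.
move=> z A /nbhs_ballP[e /= e0 eA].
rewrite nbhs_simpl /= {1}/nbhs /= /cone_nbhs; case: ifPn => z0.
  exists e => //= w we; apply: eA; rewrite /ball/= (eqP z0) sub0r normrN.
  by rewrite ger0_norm// cradius_ge0.
have : \forall a \near crepr z, A a.2%:num.
  by apply: (@snd_num_continuous X R (crepr z) A); apply/nbhs_ballP; exists e.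
by apply: filterS => a Aa /=; rewrite cradiusE.
Qed.

Lemma cbase_continuous_at (z : C) : cradius z != 0 -> {for z, continuous (cbase : C -> X)}.
Proof.
move=> z0 A zA; rewrite nbhs_simpl /= {1}/nbhs /= /cone_nbhs (negbTE z0).
have pos : \forall a \near crepr z, (a.2%:num : R) != 0.
  have z1 : 0 < (crepr z).2%:num by rewrite lt0r z0 /=.
  have : \forall a \near crepr z, 0 < (a.2%:num : R).
    exact: (@snd_num_continuous X R (crepr z) _ (lt_nbhsr z1)).
  by apply: filterS => a; exact: lt0r_neq0.
have nA : \forall a \near crepr z, A a.1 by exact: (@cvg_fst _ _ (nbhs (crepr z).1) (nbhs (crepr z).2) _ A zA).
apply: filterS2 pos nA => -[x r] /= r0 Ax.
by rewrite cbaseE.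
Qed.

Lemma cptr_continuous (a : X * R) : {for a, continuous (fun a : X * R => cptr a.1 a.2)}.
Proof.
apply: cone_cvg.
  under eq_fun do rewrite cradius_cptr.
  rewrite cradius_cptr; apply: cvg_norm; exact: cvg_snd.
rewrite cradius_cptr normr_eq0 => a0; rewrite cbase_cptr//.
have cf : b.1 @[b --> a] --> a.1 by exact: cvg_fst.
apply: cvg_trans cf.
apply: near_eq_cvg.
have : \forall b \near a, b.2 != 0.
  have cs : b.2 @[b --> a] --> a.2 by exact: cvg_snd.
  apply: (cs [set r | r != 0]).
  exact: (open_nbhs_nbhs (conj (@open_neq _ 0) a0)).
by apply: filterS => b b0; rewrite /= cbase_cptr.
Qed.

Lemma open_cradius_neq0 : open [set z : C | cradius z != 0].
Proof.
rewrite (_ : mkset _ = cradius @^-1` [set r | r != 0]); last by [].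
apply: open_comp; first by move=> z _; exact: cradius_continuous.
exact: open_neq.
Qed.

(** The radius separates points with different radii, and away from the vertex
    the base point is continuous. *)
Lemma cone_hausdorff : hausdorff_space X -> hausdorff_space C.
Proof.
move=> hX z w zw.
have rzw : cradius z = cradius w.
  apply: (@Rhausdorff R); apply: (cluster_continuous (f := cradius) _ _ zw);
    exact: cradius_continuous.
apply: cone_eq => // z0; apply: hX.
apply: (cluster_continuous (f := cbase) _ _ zw); apply: cbase_continuous_at => //.
by rewrite -rzw.
Qed.

Lemma open_cradius_neq0_comp (S : topologicalType) (f : S -> C) :
  continuous f -> open [set s | cradius (f s) != 0].
Proof.
move=> cf; apply: (open_comp (f := f) (D := [set v | cradius v != 0])).
  by move=> s _; exact: cf.
exact: open_cradius_neq0.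
Qed.

Lemma cradius_measurable : measurable_fun [set: borel C] (cradius : borel C -> R).
Proof. by apply: continuous_measurable_real; exact: cradius_continuous. Qed.

(** [cbase] is an arbitrary but fixed point at the vertex, hence Borel. *)
Lemma cbase_measurable : measurable_fun [set: borel C] (cbase : borel C -> borel X).
Proof.
apply: (measurable_borel_const_off (t := cbase (vertex : C)) open_cradius_neq0).
- by move=> z; rewrite inE /= => z0; exact: cbase_continuous_at.
- by move=> z /negP; rewrite negbK => /eqP/cradius0_vertex ->.
Qed.

Definition cscale (l : R) (z : C) : C := cptr (cbase z) (l * cradius z).

Lemma cradius_cscale l z : 0 <= l -> cradius (cscale l z) = l * cradius z.
Proof.
by move=> l0; rewrite /cscale cradius_cptr ger0_norm// mulr_ge0// cradius_ge0.
Qed.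

Lemma cbase_cscale l z : l != 0 -> cbase (cscale l z) = cbase z.
Proof.
move=> l0; have [z0|z0] := eqVneq (cradius z) 0; last first.
  by rewrite /cscale cbase_cptr// mulf_neq0.
by rewrite /cscale z0 mulr0 cptr0 [in RHS](cradius0_vertex z0).
Qed.

(** [cdiv w w] has radius 1 unless [w] is the vertex, so this is the rescaling
    of the pair [(z, w)] that normalises its second entry. When [w] is the
    vertex the convention [0^-1 = 0] gives the vertex. *)
Definition cdiv (z w : C) : C := cscale (cradius w)^-1 z.

Lemma cdiv_continuous_at (z w : C) : cradius w != 0 ->
  {for (z, w), continuous (fun u : C * C => cdiv u.1 u.2)}.
Proof.
move=> w0; have l0 : (cradius w)^-1 != 0 by rewrite invr_eq0.
have rz : cradius u.1 @[u --> (z, w)] --> cradius z.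
  apply: (@cvg_comp _ _ _ fst (cradius : C -> R)); [exact: cvg_fst|exact: cradius_continuous].
have rw : cradius u.2 @[u --> (z, w)] --> cradius w.
  apply: (@cvg_comp _ _ _ snd (cradius : C -> R)); [exact: cvg_snd|exact: cradius_continuous].
have wge0 (v : C) : 0 <= (cradius v)^-1 by rewrite invr_ge0 cradius_ge0.
apply: cone_cvg => /=.
  under eq_fun do rewrite cradius_cscale//.
  rewrite cradius_cscale//; apply: cvgM => //; exact: cvgV.
rewrite cradius_cscale// mulf_eq0 negb_or => /andP[_ z0].
rewrite cbase_cscale//.
apply: cvg_trans (_ : cbase u.1 @[u --> (z, w)] --> cbase z); last first.
  apply: (@cvg_comp _ _ _ fst (cbase : C -> X)); [exact: cvg_fst|exact: cbase_continuous_at].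
apply: near_eq_cvg.
have : \forall u \near (z, w), cradius u.2 != 0.
  apply: (rw [set r | r != 0]).
  exact: (open_nbhs_nbhs (conj (@open_neq _ 0) w0)).
by apply: filterS => u u0; rewrite /cdiv/= cbase_cscale// invr_eq0.
Qed.

End cone_topology.

(** * Homogeneous plans *)

(** This is the convexity of the power function with weights [A / (A + B)] and
    [B / (A + B)], applied to [a] and [b] divided by these weights. It is an
    equality at [(A, B)], which is why integrating it gives the triangle
    inequality of the p-norm (Minkowski); being linear in the two powers, it
    also makes sense for infinite values of the cost. *)
Lemma powR_weighted_convexity (R : realType) (p A B : R) :
  1 <= p -> 0 < A -> 0 < B ->
  exists c1 c2 : R, [/\ 1 <= c1, 1 <= c2,
    forall a b : R, 0 <= a -> 0 <= b ->
      (a + b) `^ p <= c1 * a `^ p + c2 * b `^ p &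
    c1 * A `^ p + c2 * B `^ p = (A + B) `^ p].
Proof.
move=> p1 A0 B0; have AB0 : 0 < A + B by rewrite addr_gt0.
have AB : A + B != 0 by rewrite gt_eqF.
pose t := A / (A + B); pose u := B / (A + B).
have tu : t + u = 1 by rewrite /t /u -mulrDl mulfV.
have t0 : 0 < t by rewrite divr_gt0.
have u0 : 0 < u by rewrite divr_gt0.
have weight_ge1 (v : R) : 0 < v -> v <= 1 -> 1 <= v * v^-1 `^ p.
  move=> v0 v1; rewrite -(mulfV (lt0r_neq0 v0)) ler_pM2l//.
  by rewrite -[leLHS]powRr1 ?invr_ge0 ?(ltW v0)// ler_powR// invf_ge1.
exists (t * t^-1 `^ p), (u * u^-1 `^ p); split.
- by apply: weight_ge1 => //; rewrite -tu lerDl ltW.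
- by apply: weight_ge1 => //; rewrite -tu lerDr ltW.
- move=> a b a0 b0.
  have t_ge0 := ltW t0; have u_ge0 := ltW u0.
  have t1 : t <= 1 by rewrite -tu lerDl.
  have at0 : 0 <= a / t by rewrite divr_ge0.
  have bu0 : 0 <= b / u by rewrite divr_ge0.
  have nng (x : R) : 0 <= x -> x \in `[0, +oo[%classic.
    by move=> x0; rewrite inE/= in_itv/= andbT.
  have : (t * (a / t) + (1 - t) * (b / u)) `^ p <=
      t * (a / t) `^ p + (1 - t) * (b / u) `^ p.
    exact: (@convex_powR R p p1 (Itv01 t_ge0 t1) (a / t) (b / u) (nng _ at0) (nng _ bu0)).
  rewrite (_ : 1 - t = u); last by rewrite -tu addrC addKr.
  rewrite [t * (a / t)]mulrCA [u * (b / u)]mulrCA !mulfV ?lt0r_neq0// !mulr1.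
  rewrite !powRM ?invr_ge0//.
  by rewrite [a `^ p * _]mulrC [b `^ p * _]mulrC !mulrA.
- rewrite -(mulrA t) -(mulrA u) -!powRM ?invr_ge0 ?ltW//.
  have -> : t^-1 * A = A + B by rewrite /t invf_div mulfVK ?gt_eqF.
  have -> : u^-1 * B = A + B by rewrite /u invf_div mulfVK ?gt_eqF.
  by rewrite -(mulrDl t u) tu mul1r.
Qed.

Section plans.
Context {R : realType} {X : ptopologicalType}.
Hypothesis hX : hausdorff_space X.
Local Notation C := (cone X R).
Local Open Scope ereal_scope.

Let hC : hausdorff_space C := cone_hausdorff hX.
Let hCC : hausdorff_space (C * C)%type := hausdorff_prod hC hC.

Lemma fst_borel_measurable (S T : ptopologicalType) :
  measurable_fun [set: borel (S * T)%type] (fst : borel (S * T)%type -> borel S).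
Proof.
by apply: (continuous_borel_measurable (S := (S * T)%type)) => x; exact: cvg_fst.
Qed.

Lemma snd_borel_measurable (S T : ptopologicalType) :
  measurable_fun [set: borel (S * T)%type] (snd : borel (S * T)%type -> borel T).
Proof.
by apply: (continuous_borel_measurable (S := (S * T)%type)) => x; exact: cvg_snd.
Qed.

(** The density against which a plan is integrated to obtain the value at [A]
    of a homogeneous marginal. *)
Definition mass (A : set X) (z : C) : R := (cradius z * \1_A (cbase z))%R.

Lemma mass_ge0 A z : (0 <= mass A z)%R.
Proof. by rewrite /mass mulr_ge0// cradius_ge0. Qed.

Lemma mass_vertex A : mass A vertex = 0%R.
Proof. by rewrite /mass cradius_vertex mul0r. Qed.

Lemma massT z : mass setT z = cradius z.
Proof. by rewrite /mass indicT mulr1. Qed.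

Lemma mass_cscale A l z : (0 <= l)%R -> mass A (cscale l z) = (l * mass A z)%R.
Proof.
move=> l0; have [->|ln0] := eqVneq l 0%R.
  by rewrite /cscale mul0r cptr0 mass_vertex mul0r.
by rewrite /mass cradius_cscale// cbase_cscale// mulrA.
Qed.

Lemma measurable_mass (A : set (borel X)) : measurable A ->
  measurable_fun [set: borel C] (mass A : borel C -> R).
Proof.
move=> mA; apply: measurable_funM; first exact: cradius_measurable.
apply: (measurableT_comp (f := \1_A : borel X -> R) (g := cbase : borel C -> borel X)).
  exact: measurable_indic.
exact: cbase_measurable.
Qed.

Lemma measurable_mass_comp d (S : measurableType d) (f : S -> C) (A : set (borel X)) :
  measurable A -> measurable_fun [set: S] (f : S -> borel C) ->
  measurable_fun [set: S] (fun x => (mass A (f x))%:E).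
Proof.
move=> mA mf; apply/measurable_EFinP.
exact: (measurableT_comp (measurable_mass mA) mf).
Qed.

(** At radius 0 the integrand vanishes, so the domain of integration can be
    absorbed into the density [mass A], which turns marginals into integrals
    over the whole space. *)
Lemma homogeneous_marginalE
    (alpha : {finite_measure set (borel (C * C)%type) -> \bar R})
    (pr : C * C -> C) (mu : {finite_measure set (borel X) -> \bar R}) :
  homogeneous_marginal alpha pr mu <->
  forall A : set (borel X), measurable A -> mu A = \int[alpha]_z (mass A (pr z))%:E.
Proof.
suff massE (A : set (borel X)) : \int[alpha]_(z in [set z | (0 < cradius (pr z))%R /\
    A (cbase (pr z))]) (cradius (pr z))%:E = \int[alpha]_z (mass A (pr z))%:E.
  by split => mar A mA; rewrite mar.
rewrite integral_mkcond; apply: eq_integral => z _; rewrite patchE /mass indicE.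
case: ifPn => [/set_mem[_ Az]|/negP nz]; first by rewrite mem_set// mulr1.
have [/set_mem Az|_] := boolP (_ \in A); last by rewrite mulr0.
rewrite mulr1; have := cradius_ge0 (pr z); rewrite le_eqVlt => /predU1P[<-//|r0].
by exfalso; apply: nz; rewrite inE; split.
Qed.

(** The moment condition of [H1] follows from the marginal conditions on the
    whole space, because the marginals are finite. *)
Lemma exists_plan (mu nu : {finite_measure set (borel X) -> \bar R})
    (f : {measure set (borel (C * C)%type) -> \bar R}) :
  f setT < +oo -> inner_regular f ->
  (forall A : set (borel X), measurable A -> mu A = \int[f]_z (mass A z.1)%:E) ->
  (forall A : set (borel X), measurable A -> nu A = \int[f]_z (mass A z.2)%:E) ->
  exists2 alpha, H1 mu nu alpha &
    forall g : C * C -> \bar R, \int[alpha]_z g z = \int[f]_z g z.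
Proof.
move=> fT fK fmu fnu; have [a aM aE] := exists_Mplus hCC fT fK.
have aI (g : C * C -> \bar R) : \int[a]_z g z = \int[f]_z g z.
  by apply: eq_measure_integral => A mA _; exact: aE.
exists a => //; split => //.
- rewrite aI; under eq_integral do rewrite EFinD -!massT.
  rewrite ge0_integralD//.
  + rewrite -fmu// -fnu//.
    by rewrite -ge0_fin_numE ?adde_ge0// fin_numD !fin_num_measure.
  + by move=> z _; rewrite lee_fin mass_ge0.
  + by apply: measurable_mass_comp => //; exact: fst_borel_measurable.
  + by move=> z _; rewrite lee_fin mass_ge0.
  + by apply: measurable_mass_comp => //; exact: snd_borel_measurable.
- by apply/homogeneous_marginalE => A mA; rewrite aI fmu.
- by apply/homogeneous_marginalE => A mA; rewrite aI fnu.
Qed.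

Lemma plan_mass1 mu nu alpha : H1 mu nu alpha ->
  forall A : set (borel X), measurable A -> mu A = \int[alpha]_z (mass A z.1)%:E.
Proof. by case=> _ _ /homogeneous_marginalE. Qed.

Lemma plan_mass2 mu nu alpha : H1 mu nu alpha ->
  forall A : set (borel X), measurable A -> nu A = \int[alpha]_z (mass A z.2)%:E.
Proof. by case=> _ _ _ /homogeneous_marginalE. Qed.

Lemma plan_inner_regular (mu nu : {finite_measure set (borel X) -> \bar R}) alpha :
  H1 mu nu alpha -> inner_regular alpha.
Proof. by case=> /(Mplus_inner_regular hCC). Qed.

Lemma finite_measure_lty d (S : measurableType d) (m : {finite_measure set S -> \bar R}) :
  m setT < +oo.
Proof. by have := fin_num_measure m setT measurableT; rewrite ge0_fin_numE. Qed.

Section pushforward_plan.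
Variables (S : ptopologicalType).
Hypothesis hS : hausdorff_space S.

Lemma pushforward_continuous (f : S -> C * C)
  (m : {finite_measure set (borel S) -> \bar R}) :
  continuous f -> inner_regular m ->
  exists n : {measure set (borel (C * C)%type) -> \bar R},
  [/\ n setT < +oo, inner_regular n &
    forall g : C * C -> \bar R,
      measurable_fun [set: borel (C * C)%type] (g : borel (C * C)%type -> \bar R) ->
      (forall z, 0 <= g z) -> \int[n]_z g z = \int[m]_x g (f x)].
Proof.
move=> cf mK; have mf := continuous_borel_measurable cf.
have [n [nE nI]] := exists_pushforward m mf; exists n; split => //.
- by rewrite nE preimage_setT finite_measure_lty.
- apply: (inner_regular_pushforward hS hCC mf openT) mK => [x _||A]; [exact: cf| |exact: nE].
  by rewrite setCT; exact: (measure0 m).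
Qed.

End pushforward_plan.

Section cost.
Variable (c : C * C -> \bar R).
Hypothesis mc : measurable_fun [set: borel (C * C)%type] (c : borel (C * C)%type -> \bar R).
Hypothesis c_ge0 : forall z, 0 <= c z.

Lemma plan_swap (mu nu : {finite_measure set (borel X) -> \bar R}) alpha :
  (forall z, c (z.2, z.1) = c z) ->
  H1 mu nu alpha ->
  exists2 beta, H1 nu mu beta & \int[beta]_z c z = \int[alpha]_z c z.
Proof.
move=> c_sym aH.
have cs : continuous (fun z : C * C => (z.2, z.1)).
  by exact: swap_continuous.
have [n [nT nK nI]] := pushforward_continuous hCC cs (plan_inner_regular aH).
have [beta bH bI] : exists2 beta, H1 nu mu beta &
    forall g : C * C -> \bar R, \int[beta]_z g z = \int[n]_z g z.
  apply: exists_plan => // A mA; rewrite nI ?(plan_mass1 aH)// ?(plan_mass2 aH)//.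
  - by apply: measurable_mass_comp => //; exact: fst_borel_measurable.
  - by move=> z; rewrite lee_fin mass_ge0.
  - by apply: measurable_mass_comp => //; exact: snd_borel_measurable.
  - by move=> z; rewrite lee_fin mass_ge0.
exists beta; first exact: bH.
rewrite bI (nI c mc c_ge0); congr (integral _ _ _); apply/funext => z.
exact: c_sym.
Qed.

Lemma integral_mass_cptr1 (mu : {finite_measure set (borel X) -> \bar R})
  (A : set (borel X)) : measurable A -> \int[mu]_x (mass A (cptr x 1))%:E = mu A.
Proof.
move=> mA; under eq_integral do
  rewrite /mass cradius_cptr normr1 mul1r cbase_cptr ?oner_eq0//.
by rewrite integral_indic// setIT.
Qed.

Lemma cptr1_continuous : continuous (fun x : X => cptr x 1 : C).
Proof.
move=> x; have cb y : cbase (cptr y 1 : C) = y by rewrite cbase_cptr ?oner_eq0.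
apply: cone_cvg => [|_].
  under eq_fun do rewrite cradius_cptr.
  by rewrite cradius_cptr; exact: cvg_cst.
by under eq_fun do rewrite cb; rewrite cb; exact: cvg_id.
Qed.

Lemma diagonal_plan (mu : {finite_measure set (borel X) -> \bar R}) :
  Mplus X R mu -> (forall z, c (z, z) = 0) ->
  exists2 alpha, H1 mu mu alpha & \int[alpha]_z c z = 0.
Proof.
move=> /(Mplus_inner_regular hX) muK c0.
have cd : continuous (fun x : X => (cptr x 1, cptr x 1) : C * C).
  by move=> x; exact: (cvg_pair (cptr1_continuous (x:=x)) (cptr1_continuous (x:=x))).
have [n [nT nK nI]] := pushforward_continuous hX cd muK.
have [beta bH bI] : exists2 beta, H1 mu mu beta &
    forall g : C * C -> \bar R, \int[beta]_z g z = \int[n]_z g z.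
  apply: exists_plan => // A mA; rewrite nI ?integral_mass_cptr1//.
  - by apply: measurable_mass_comp => //; exact: fst_borel_measurable.
  - by move=> z; rewrite lee_fin mass_ge0.
  - by apply: measurable_mass_comp => //; exact: snd_borel_measurable.
  - by move=> z; rewrite lee_fin mass_ge0.
by exists beta => //; rewrite bI nI// integral0_eq.
Qed.

(** Destroy all of [mu] and create all of [nu], both through the vertex. *)
Lemma vertex_plan (mu nu : {finite_measure set (borel X) -> \bar R}) :
  Mplus X R mu -> Mplus X R nu ->
  exists2 alpha, H1 mu nu alpha & \int[alpha]_z c z =
    \int[mu]_x c (cptr x 1, vertex) + \int[nu]_x c (vertex, cptr x 1).
Proof.
move=> /(Mplus_inner_regular hX) muK /(Mplus_inner_regular hX) nuK.
have c1 : continuous (fun x : X => (cptr x 1, vertex) : C * C).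
  by move=> x; exact: (cvg_pair (cptr1_continuous (x:=x)) (cvg_cst _)).
have c2 : continuous (fun x : X => (vertex, cptr x 1) : C * C).
  by move=> x; exact: (cvg_pair (cvg_cst _) (cptr1_continuous (x:=x))).
have [m [mT mK mI]] := pushforward_continuous hX c1 muK.
have [n [nT nK nI]] := pushforward_continuous hX c2 nuK.
pose s : {measure set (borel (C * C)%type) -> \bar R} := measure_add m n.
have sE A : s A = m A + n A by exact: measure_addE.
have sI (g : C * C -> \bar R) :
      measurable_fun [set: borel (C * C)%type] (g : borel (C * C)%type -> \bar R) ->
      (forall z, 0 <= g z) -> \int[s]_z g z = \int[mu]_x g (cptr x 1, vertex) + \int[nu]_x g (vertex, cptr x 1).
  by move=> mg g0; rewrite ge0_integral_measure_add// mI// nI.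
have [beta bH bI] : exists2 beta, H1 mu nu beta &
    forall g : C * C -> \bar R, \int[beta]_z g z = \int[s]_z g z.
  apply: exists_plan.
  - by rewrite sE lte_add_pinfty.
  - by apply: (inner_regular_add hCC mK nK) => A mA; rewrite sE.
  - move=> A mA; rewrite sI/= ?mass_vertex ?integral_cst ?mul0e ?adde0 ?integral_mass_cptr1//.
    + by apply: measurable_mass_comp => //; exact: fst_borel_measurable.
    + by move=> z; rewrite lee_fin mass_ge0.
  - move=> A mA; rewrite sI/= ?mass_vertex ?integral_cst ?mul0e ?add0e ?integral_mass_cptr1//.
    + by apply: measurable_mass_comp => //; exact: snd_borel_measurable.
    + by move=> z; rewrite lee_fin mass_ge0.
by exists beta => //; rewrite bI sI.
Qed.

End cost.

End plans.

(** * Measures at distance zero *)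

Lemma ereal_gt0_lb (R : realType) (x : \bar R) :
  (0 < x)%E -> exists2 m : R, 0 < m & (m%:E < x)%E.
Proof.
case: x => [r| |]//; last by exists 1 => //; rewrite ltry.
by rewrite lte_fin => r0; exists (r / 2); rewrite ?divr_gt0// lte_fin ltr_pdivrMr// ltr_pMr// ltr1n.
Qed.

Lemma lsc_compact_lower_bound (R : realType) (S T : topologicalType)
    (f : S -> T) (g : T -> \bar R) (K : set S) :
  continuous f -> lower_semicontinuous g -> compact K ->
  (forall x, K x -> (0 < g (f x))%E) ->
  exists2 m : R, 0 < m & forall x, K x -> (m%:E <= g (f x))%E.
Proof.
move=> cf lscg cK gK.
have [m m0 Km] : exists2 m : R, 0 < m & forall x, K x -> K x -> (m%:E <= g (f x))%E.
  apply: (compact_ind cK (P := fun A => exists2 m : R, 0 < m &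
    forall x, A x -> K x -> (m%:E <= g (f x))%E)).
  - by exists 1.
  - by move=> A B AB [m m0 Bm]; exists m => // x /AB; exact: Bm.
  - move=> A B [m m0 Am] [n n0 Bn]; exists (Num.min m n); first by rewrite lt_min m0.
    by move=> x [/Am|/Bn] + Kx => /(_ Kx); apply: le_trans; rewrite lee_fin ge_min lexx ?orbT.
  - move=> x Kx; have [m m0 mg] := ereal_gt0_lb (gK _ Kx).
    have [V xV Vm] := lscg _ _ mg.
    exists (f @^-1` V); first exact: cf.
    by exists m => // y Vy _; exact/ltW/Vm.
by exists m => // x Kx; exact: Km.
Qed.

(** If plans from [mu] to [nu] have arbitrarily small cost then [mu K <= nu K]
    for compact [K]. The cost is bounded below on
    compact sets away from the diagonal, and this bounds the mass leaving [K],
    in the form of a pointwise inequality of homogeneous functions that can be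
    integrated against any plan. *)
Section definiteness.
Context {R : realType} {X : ptopologicalType}.
Hypothesis hX : hausdorff_space X.
Local Notation C := (cone X R).
Local Open Scope ereal_scope.
Variable (c : C * C -> \bar R).
Hypothesis c_lsc : lower_semicontinuous c.
Hypothesis c_ge0 : forall z, 0 <= c z.
Hypothesis c_eq0 : forall z, c z = 0 -> z.1 = z.2.
Hypothesis c_scale : forall (l : R) (z w : C), (0 < l)%R ->
  c (cscale l z, cscale l w) = l%:E * c (z, w).

Let c_gt0 z : z.1 <> z.2 -> 0 < c z.
Proof. by move=> z12; rewrite lt0e c_ge0 andbT; apply/eqP => /c_eq0. Qed.

(** The neighbourhoods of the vertex are defined by the radius alone, so the
    bound is uniform over all base points of the second entry, in a compact set
    or not. This is what replaces tightness of the plans. *)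
Lemma cost_near_vertex (K : set X) : compact K -> exists m eta : R,
  [/\ (0 < m)%R, (0 < eta)%R & forall x w, K x -> (cradius w < eta)%R ->
    m%:E <= c (cptr x 1, w)].
Proof.
move=> cK; apply: (compact_ind cK (P := fun A => exists m eta : R,
  [/\ (0 < m)%R, (0 < eta)%R & forall x w, A x -> (cradius w < eta)%R ->
    m%:E <= c (cptr x 1, w)])).
- by exists 1%R, 1%R; split.
- by move=> A B AB [m [eta [m0 e0 Bm]]]; exists m, eta; split => // x w /AB; exact: Bm.
- move=> A B [m [d [m0 d0 Am]]] [n [e [n0 e0 Bn]]].
  exists (Num.min m n), (Num.min d e); split; rewrite ?lt_min ?m0 ?d0//.
  move=> x w [Ax|Bx]; rewrite lt_min => /andP[wd we].
    by apply: le_trans (Am _ _ Ax wd); rewrite lee_fin ge_min lexx.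
  by apply: le_trans (Bn _ _ Bx we); rewrite lee_fin ge_min lexx orbT.
- move=> x Kx.
  have /c_gt0/ereal_gt0_lb[m m0 mc] : (cptr x 1 : C, vertex : C).1 <> (cptr x 1 : C, vertex : C).2.
    move=> /= /(congr1 cradius); rewrite cradius_cptr cradius_vertex normr1 => /eqP.
    by rewrite oner_eq0.
  have [V [[A B] [/= xA vB] ABV] Vm] := c_lsc mc.
  have [eta eta0 etaB] : exists2 eta : R, (0 < eta)%R & forall w : C, (cradius w < eta)%R -> B w.
    move: vB; rewrite /nbhs /= /cone_nbhs cradius_vertex eqxx => -[e e0 eB].
    by exists e.
  exists ((fun y : X => cptr y 1) @^-1` A); first exact: (cptr1_continuous xA).
  exists m, eta; split => // y w Ay we.
  by apply/ltW/Vm/(ABV (_, _)); split => //=; exact: etaB.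
Qed.

Lemma mass_in (A : set X) (z : C) : A (cbase z) -> mass A z = cradius z.
Proof. by move=> Az; rewrite /mass indicE mem_set// mulr1. Qed.

Lemma cost_compact_lower_bound (K L : set X) (b : R) :
  compact K -> compact L -> (0 <= b)%R ->
  (forall x y r, K x -> L y -> (0 <= r <= b)%R -> cptr x 1 <> cptr y r :> C) ->
  exists2 m : R, (0 < m)%R & forall x w, K x -> L (cbase w) -> (cradius w <= b)%R ->
    m%:E <= c (cptr x 1, w).
Proof.
move=> cK cL b0 KL.
pose f (u : X * (X * R)) : C * C := (cptr u.1 1, cptr u.2.1 u.2.2).
have cf : continuous f.
  move=> u.
  have c1 : {for u, continuous (fun u : X * (X * R) => cptr u.1 1 : C)}.
    apply: (@continuous_comp _ _ _ fst (fun x : X => cptr x 1 : C)).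
      exact: cvg_fst.
    exact: cptr1_continuous.
  have c2 : {for u, continuous (fun u : X * (X * R) => cptr u.2.1 u.2.2 : C)}.
    apply: (@continuous_comp _ _ _ snd (fun a : X * R => cptr a.1 a.2 : C)).
      exact: cvg_snd.
    exact: cptr_continuous.
  exact: (cvg_pair c1 c2).
have cQ : compact (K `*` (L `*` `[0%R, b]%classic)).
  by apply: compact_setX => //; apply: compact_setX => //; exact: segment_compact.
have [|m m0 mQ] := lsc_compact_lower_bound cf c_lsc cQ.
  move=> [x [y r]] [/= Kx [/= Ly]]; rewrite in_itv/= => rb.
  by apply: c_gt0 => /=; exact: KL.
exists m => // x w Kx Lw wb; rewrite -(cptr_cone w).
apply: (mQ (x, (cbase w, cradius w))); split => //=; split => //=.
by rewrite in_itv/= cradius_ge0.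
Qed.

(* Both sides are 1-homogeneous, so let [z = ([x, 1], [y, r])] with [x] in [K].
   If r < eta, or if y is in K and r <= d, or if y is in L and r <= B, the cost
   is at least m. Otherwise one of the mass terms is at least 1: the first one
   if y is in K and r > d, the second if y is in L and r > B, and the third if
   y is outside K and L. *)
Let pointwise (K L : set X) (d B eta : R) (m : R) z :
  (0 < d)%R -> (0 < B)%R -> (0 < eta)%R -> (0 < m)%R ->
  (forall x w, K x -> (cradius w < eta)%R -> m%:E <= c (cptr x 1, w)) ->
  (forall x w, K x -> K (cbase w) -> (cradius w <= d)%R -> m%:E <= c (cptr x 1, w)) ->
  (forall x w, K x -> L (cbase w) -> (cradius w <= B)%R -> m%:E <= c (cptr x 1, w)) ->
  (mass K z.1)%:E <= (d^-1 * mass K z.2)%:E + (B^-1 * mass setT z.2)%:E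
     + (eta^-1 * mass (~` (K `|` L)) z.2)%:E + m^-1%:E * c z.
Proof.
move=> d0 B0 e0 m0 m1 m2 m3.
have nn (s : R) (A : set X) w : (0 < s)%R -> (0 <= s^-1 * mass A w)%R.
  by move=> s0; rewrite mulr_ge0 ?mass_ge0// invr_ge0 ltW.
have rhs_ge0 w : 0 <= (d^-1 * mass K w)%:E + (B^-1 * mass setT w)%:E
     + (eta^-1 * mass (~` (K `|` L)) w)%:E.
  by rewrite -!EFinD lee_fin !addr_ge0// nn.
have normalized x w : K x -> 1 <= (d^-1 * mass K w)%:E + (B^-1 * mass setT w)%:E
     + (eta^-1 * mass (~` (K `|` L)) w)%:E + m^-1%:E * c (cptr x 1, w).
  move=> Kx.
  have cost_ge1 : m%:E <= c (cptr x 1, w) -> 1 <= m^-1%:E * c (cptr x 1, w).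
    move=> mc; rewrite (@le_trans _ _ (m^-1%:E * m%:E))//.
      by rewrite -EFinM mulVf ?gt_eqF.
    by rewrite lee_wpmul2l// lee_fin invr_ge0 ltW.
  have costP : m%:E <= c (cptr x 1, w) -> 1 <= (d^-1 * mass K w)%:E +
      (B^-1 * mass setT w)%:E + (eta^-1 * mass (~` (K `|` L)) w)%:E +
      m^-1%:E * c (cptr x 1, w).
    by move=> /cost_ge1 /le_trans; apply; rewrite leeDr.
  have massP : (1 <= d^-1 * mass K w + B^-1 * mass setT w
      + eta^-1 * mass (~` (K `|` L)) w)%R ->
    1 <= (d^-1 * mass K w)%:E + (B^-1 * mass setT w)%:E
     + (eta^-1 * mass (~` (K `|` L)) w)%:E + m^-1%:E * c (cptr x 1, w).
    move=> h; rewrite (@le_trans _ _ (d^-1 * mass K w + B^-1 * mass setT w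
      + eta^-1 * mass (~` (K `|` L)) w)%:E)//.
    by rewrite !EFinD leeDl// mule_ge0// lee_fin invr_ge0 ltW.
  have [we|we] := ltP (cradius w) eta; first by apply: costP; exact: m1.
  have [Kw|nKw] := pselect (K (cbase w)).
    have [wd|wd] := leP (cradius w) d; first by apply: costP; exact: m2.
    apply: massP => //; rewrite -addrA (@le_trans _ _ (d^-1 * mass K w)%R)//.
      by rewrite mass_in// ler_pdivlMl// mulr1 ltW.
    by rewrite lerDl addr_ge0// nn.
  have [Lw|nLw] := pselect (L (cbase w)).
    have [wB|wB] := leP (cradius w) B; first by apply: costP; exact: m3.
    apply: massP => //; rewrite addrAC (@le_trans _ _ (B^-1 * mass setT w)%R)//.
      by rewrite mass_in// ler_pdivlMl// mulr1 ltW.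
    by rewrite lerDr addr_ge0// nn.
  apply: massP => //; rewrite (@le_trans _ _ (eta^-1 * mass (~` (K `|` L)) w)%R)//.
    by rewrite mass_in ?ler_pdivlMl ?mulr1// => -[].
  by rewrite lerDr addr_ge0// nn.
case: z => z w /=.
have [Kz|nKz] := pselect (K (cbase z)); last first.
  by rewrite {1}/mass indicE memNset// mulr0 adde_ge0// mule_ge0// lee_fin invr_ge0 ltW.
rewrite mass_in//; have := cradius_ge0 z; rewrite le_eqVlt => /predU1P[<-|z0].
  by rewrite adde_ge0// mule_ge0// lee_fin invr_ge0 ltW.
pose r := cradius z; have r0 : (r != 0)%R by rewrite gt_eqF.
have rV : (0 <= r^-1)%R by rewrite invr_ge0 cradius_ge0.
have zE : z = cscale r (cptr (cbase z) 1).
  by rewrite /cscale cradius_cptr normr1 mulr1 cbase_cptr ?oner_eq0// cptr_cone.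
have wE : w = cscale r (cscale r^-1 w).
  rewrite {1}/cscale cbase_cscale ?invr_eq0// cradius_cscale// mulrA mulfV// mul1r.
  by rewrite cptr_cone.
have {normalized} := normalized (cbase z) (cscale r^-1 w) Kz.
rewrite -(@lee_pmul2l _ r%:E)// ?lte_fin// mule1 => /le_trans; apply.
rewrite ge0_muleDr ?rhs_ge0//; last by rewrite mule_ge0// lee_fin invr_ge0 ltW.
rewrite muleCA -(c_scale _ _ z0) -zE -wE leeD2r// -!EFinD -EFinM lee_fin.
have cancel a A : (r * (a * mass A (cscale r^-1 w)) = a * mass A w)%R.
  by rewrite mass_cscale// mulrCA mulVKf.
by rewrite !mulrDr !cancel.
Qed.

(** For a given tolerance [t], the compact set [L] exhausts the complement of
    [K] for [nu] up to [t * eta]; here it is essential that [eta] depends only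
    on [K]. Integrating the pointwise inequality with [d = 1 / (1 + t)],
    [B = 1 / t] and a plan of cost at most [t * m] gives
    [mu K <= nu K + t * N] with [N] independent of [t]. *)
Lemma plan_cost0_le (mu nu : {finite_measure set (borel X) -> \bar R}) :
  Mplus X R mu -> Mplus X R nu ->
  (forall e : R, (0 < e)%R -> exists2 alpha, H1 mu nu alpha & \int[alpha]_z c z <= e%:E) ->
  forall A : set (borel X), measurable A -> mu A <= nu A.
Proof.
move=> muM nuM small.
have muK := Mplus_inner_regular hX muM; have nuK := Mplus_inner_regular hX nuM.
suff main (K : set X) : compact K -> mu K <= nu K.
  move=> A mA; apply/lee_addgt0Pr => e e0; have [K [cK KA AK]] := muK _ mA _ e0.
  have mK := compact_borel hX cK.
  have -> : mu A = mu K + mu (A `\` K).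
    rewrite -measureU// ?setDUK//; first exact: measurableD.
    by rewrite setDE setIC -setIA setICl setI0.
  by rewrite leeD// (le_trans (main _ cK))// le_measure ?inE.
move=> cK; have mK := compact_borel hX cK.
have [m1 [eta [m10 eta0 m1P]]] := cost_near_vertex cK.
pose N : R := (fine (nu K) + fine (nu setT) + 2)%R.
have N0 : (0 < N)%R by rewrite ltr_wpDl// addr_ge0// fine_ge0.
suff step (t : R) : (0 < t)%R -> mu K <= nu K + (t * N)%:E.
  apply/lee_addgt0Pr => e e0.
  by have := step (e / N)%R; rewrite divr_gt0// mulfVK ?gt_eqF// => /(_ isT).
move=> t0.
have mKc : measurable (~` K : set (borel X)) by exact: measurableC.
have te0 : (0 < t * eta)%R by rewrite mulr_gt0.
have [L [cL LK nuL]] := nuK _ mKc _ te0.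
have mL := compact_borel hX cL.
pose d := (1 + t)^-1%R; have t10 : (0 < 1 + t)%R by rewrite addr_gt0.
have d0 : (0 < d)%R by rewrite invr_gt0.
have d1 : (d < 1)%R by rewrite invf_lt1// ltrDl.
have tV0 : (0 < t^-1)%R by rewrite invr_gt0.
have [|m2 m20 m2P] := cost_compact_lower_bound cK cK (ltW d0).
  move=> x y r Kx Ky /andP[r0 rd] /(congr1 cradius).
  rewrite !cradius_cptr normr1 ger0_norm// => r1.
  by move: rd; rewrite -r1 leNgt d1.
have [|m3 m30 m3P] := cost_compact_lower_bound cK cL (ltW tV0).
  move=> x y r Kx Ly /andP[r0 rB] xy.
  have r1 : r = 1%R.
    have := congr1 cradius xy; rewrite !cradius_cptr normr1 ger0_norm//.
  apply: (LK y Ly); have := congr1 cbase xy.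
  by rewrite r1 !cbase_cptr ?oner_eq0// => <-.
pose m := Num.min m1 (Num.min m2 m3).
have m0 : (0 < m)%R by rewrite !lt_min m10 m20.
have mm1 : (m <= m1)%R by rewrite ge_min lexx.
have mm2 : (m <= m2)%R by rewrite !ge_min lexx orbT.
have mm3 : (m <= m3)%R by rewrite !ge_min lexx !orbT.
have tm0 : (0 < t * m)%R by rewrite mulr_gt0.
have [alpha aH ac] := small _ tm0.
have mKL : measurable (~` (K `|` L) : set (borel X)).
  by apply: measurableC; exact: measurableU.
have mmass (A : set (borel X)) : measurable A ->
    measurable_fun [set: borel (C * C)%type] (fun z : borel (C * C)%type => (mass A z.2)%:E).
  by move=> mA; apply: measurable_mass_comp => //; exact: snd_borel_measurable.
have mmassM (s : R) (A : set (borel X)) : measurable A ->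
    measurable_fun [set: borel (C * C)%type] (fun z : borel (C * C)%type => (s * mass A z.2)%:E).
  by move=> mA; under eq_fun do rewrite EFinM; apply: emeasurable_funM => //; exact: mmass.
have mc : measurable_fun [set: borel (C * C)%type] (c : borel (C * C)%type -> \bar R).
  exact: lsc_measurable.
have massI (s : R) (A : set (borel X)) : (0 <= s)%R -> measurable A ->
    \int[alpha]_z (s * mass A z.2)%:E = s%:E * nu A.
  move=> s0 mA; under eq_integral do rewrite EFinM.
  rewrite ge0_integralZl ?lee_fin// -?(plan_mass2 aH)//; first exact: mmass.
  by move=> z _; rewrite lee_fin mass_ge0.
have nn (s : R) (A : set X) (z : C) : (0 <= s)%R -> 0 <= (s * mass A z)%:E.
  by move=> s0; rewrite lee_fin mulr_ge0// mass_ge0.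
have dV0 : (0 <= d^-1)%R by rewrite invr_ge0 ltW.
have eV0 : (0 <= eta^-1)%R by rewrite invr_ge0 ltW.
have mV0 : (0 <= m^-1)%R by rewrite invr_ge0 ltW.
rewrite (plan_mass1 aH)//.
apply: (@le_trans _ _ (\int[alpha]_z ((d^-1 * mass K z.2)%:E + (t^-1^-1 * mass setT z.2)%:E
     + (eta^-1 * mass (~` (K `|` L)) z.2)%:E + m^-1%:E * c z))).
  apply: ge0_le_integral => //.
  - by move=> z _; rewrite lee_fin mass_ge0.
  - by apply: measurable_mass_comp => //; exact: fst_borel_measurable.
  - apply: emeasurable_funD; last by apply: emeasurable_funM.
    by do 2 (apply: emeasurable_funD; last exact: mmassM); exact: mmassM.
  - move=> z _; apply: pointwise => //.
    + by move=> x w Kx we; apply: le_trans (m1P _ _ Kx we); rewrite lee_fin.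
    + by move=> x w Kx Kw we; apply: le_trans (m2P _ _ Kx Kw we); rewrite lee_fin.
    + by move=> x w Kx Lw we; apply: le_trans (m3P _ _ Kx Lw we); rewrite lee_fin.
rewrite ge0_integralD//; last 4 first.
- by move=> z _; rewrite !adde_ge0// nn// invr_ge0 ltW.
- by do 2 (apply: emeasurable_funD; last exact: mmassM); exact: mmassM.
- by move=> z _; rewrite mule_ge0// lee_fin.
- by apply: emeasurable_funM.
rewrite ge0_integralD//; last 4 first.
- by move=> z _; rewrite !adde_ge0// nn// invr_ge0 ltW.
- by apply: emeasurable_funD; exact: mmassM.
- by move=> z _; rewrite nn.
- exact: mmassM.
rewrite ge0_integralD//; last 4 first.
- by move=> z _; rewrite nn.
- exact: mmassM.
- by move=> z _; rewrite nn// invr_ge0 ltW.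
- exact: mmassM.
have cI : \int[alpha]_z (m^-1%:E * c z) = m^-1%:E * \int[alpha]_z c z.
  by apply: (@ge0_integralZl _ _ _ _ _ _ (c : borel (C * C)%type -> \bar R)); rewrite ?lee_fin.
rewrite cI !massI ?invrK ?(ltW t0) ?(ltW t10)//.
have nuF (A : set (borel X)) : measurable A -> nu A = (fine (nu A))%:E.
  by move=> mA; rewrite fineK ?fin_num_measure.
apply: (@le_trans _ _ ((1 + t)%:E * nu K + t%:E * nu setT + t%:E + t%:E)).
  rewrite leeD//; last first.
    rewrite (@le_trans _ _ (m^-1%:E * (t * m)%:E))//; first by rewrite lee_wpmul2l ?lee_fin.
    by rewrite -EFinM mulrCA mulVf ?gt_eqF// mulr1.
  rewrite leeD2l//.
  rewrite (@le_trans _ _ (eta^-1%:E * (t * eta)%:E))//; last first.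
    by rewrite -EFinM mulrCA mulVf ?gt_eqF// mulr1.
  by rewrite lee_wpmul2l ?lee_fin// setCU.
rewrite (nuF K)// (nuF setT)// -!EFinM -!EFinD lee_fin /N.
rewrite le_eqVlt; apply/orP; left; apply/eqP; ring.
Qed.

End definiteness.

(** * Composing plans *)

(** The middle entries of two plans have the same homogeneous marginal but not
    the same law on the cone. Weighting each plan by the radius of its middle
    entry makes the laws of the middle base points agree, so the weighted plans
    can be glued over [X]; dividing the outer entries by the middle radii undoes
    the weights by homogeneity. The parts of the plans whose middle entry is
    the vertex are simply kept, since mass that passes through the vertex
    need not be matched. *)
Section glue_plans.
Context {R : realType} {X : ptopologicalType}.
Hypothesis hX : hausdorff_space X.
Local Notation C := (cone X R).
Local Notation Y := (C * C)%type.
Local Open Scope ereal_scope.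

Let hC : hausdorff_space C := cone_hausdorff hX.
Let hY : hausdorff_space Y := hausdorff_prod hC hC.

(** The weighted plan: the law of its middle base point is the homogeneous
    marginal, and it does not see the vertex. *)
Lemma plan_marginal_density (alpha : {finite_measure set (borel Y) -> \bar R})
    (pr : Y -> C) (mu : {finite_measure set (borel X) -> \bar R}) :
  continuous pr -> inner_regular alpha ->
  (forall A : set (borel X), measurable A -> mu A = \int[alpha]_z (mass A (pr z))%:E) ->
  exists a : {finite_measure set (borel Y) -> \bar R},
  [/\ inner_regular a,
    forall g : borel Y -> \bar R, measurable_fun [set: borel Y] g -> (forall y, 0 <= g y) ->
      \int[a]_z g z = \int[alpha]_z (g z * (cradius (pr z))%:E),
    forall B : set (borel X), measurable B -> a ((fun z => cbase (pr z)) @^-1` B) = mu B &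
    a [set z | cradius (pr z) = 0%R] = 0].
Proof.
move=> cpr alphaK amu.
have mpr := continuous_borel_measurable cpr.
have mr : measurable_fun [set: borel Y] (fun z : borel Y => cradius (pr z)).
  exact: (measurableT_comp cradius_measurable mpr).
have mb : measurable_fun [set: borel Y] (fun z : borel Y => cbase (pr z) : borel X).
  exact: (measurableT_comp cbase_measurable mpr).
have [n [nE nI]] := exists_density alpha mr (fun z => cradius_ge0 (pr z)).
have nB (B : set (borel X)) : measurable B -> n ((fun z => cbase (pr z)) @^-1` B) = mu B.
  move=> mB; rewrite nE ?amu//; last exact: (measurable_preimage mb).
  rewrite integral_mkcond; apply: eq_integral => z _; rewrite patchE /mass indicE.
  case: ifPn => [/set_mem Bz|/negP nBz]; first by rewrite mem_set// mulr1.
  by rewrite memNset ?mulr0// => Bz; apply: nBz; rewrite inE.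
have nT : n setT < +oo.
  by have := nB setT measurableT; rewrite preimage_setT => ->; exact: finite_measure_lty.
have nK : inner_regular n.
  apply: (inner_regular_dominated hY nT alphaK) => A mA A0; rewrite nE//.
  by apply: null_set_integral => //; exact/measurable_funTS/measurable_EFinP.
have [a aM aE] := exists_Mplus hY nT nK.
have mpreb (B : set (borel X)) : measurable B ->
  measurable ((fun z => cbase (pr z)) @^-1` B : set (borel Y)) by exact: (measurable_preimage mb).
exists a; split.
- exact: (Mplus_inner_regular hY aM).
- by move=> g mg g0; rewrite -nI//; apply: eq_measure_integral => A mA _; exact: aE.
- by move=> B mB; rewrite aE ?nB//; exact: mpreb.
- have m0 : measurable ([set z | cradius (pr z) = 0%R] : set (borel Y)).
    exact: (measurable_preimage mr (measurable_set1 0%R)).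
  by rewrite aE// nE// integral0_eq// => z ->.
Qed.

Lemma plan_residual (alpha : {finite_measure set (borel Y) -> \bar R})
    (D : set (borel Y)) :
  measurable D -> inner_regular alpha ->
  exists n : {measure set (borel Y) -> \bar R},
  [/\ n setT < +oo, inner_regular n &
    forall g : borel Y -> \bar R, measurable_fun [set: borel Y] g -> (forall y, 0 <= g y) ->
      \int[n]_z g z = \int[alpha]_z (g z * (\1_D z)%:E)].
Proof.
move=> mD alphaK.
have mi : measurable_fun [set: borel Y] (\1_D : borel Y -> R) by exact: measurable_indic.
have [|n [nE nI]] := exists_density alpha mi; first by move=> z; rewrite indicE.
have nT : n setT < +oo.
  rewrite nE// integral_indic// setIT.
  by have := fin_num_measure alpha D mD; rewrite ge0_fin_numE.
exists n; split => //.
apply: (inner_regular_dominated hY nT alphaK) => A mA A0; rewrite nE//.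
by apply: null_set_integral => //; exact/measurable_funTS/measurable_EFinP.
Qed.

Let M1 (pr : Y -> C) := [set z : Y | cradius (pr z) = 0%R].

Lemma measurable_cradiusV (pr : Y -> C) : continuous pr ->
  measurable_fun [set: borel Y] (fun z : borel Y => ((cradius (pr z))^-1)%:E).
Proof.
move=> cpr; apply/measurable_EFinP.
apply: (measurability _ (RGenOpens.measurableE R)).
move=> _ [_ [a [b ->] <-]]; rewrite setTI.
have oU := open_cradius_neq0_comp cpr.
apply: (measurable_preimage (T := borel R)
  (measurable_borel_const_off (T := R) (t := 0%R) oU _ _)); last exact: open_borel.
- move=> z; rewrite inE /= => z0.
  apply: cvgV => //; apply: (@continuous_comp _ _ _ pr cradius); first exact: cpr.
  exact: cradius_continuous.
- by move=> z /negP; rewrite negbK => /eqP ->; rewrite invr0.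
Qed.

(** Weighting by the radius and dividing by it again loses exactly the part
    where the radius is 0. *)
Lemma integral_split (alpha a : {finite_measure set (borel Y) -> \bar R})
    (n : {measure set (borel Y) -> \bar R}) (pr : Y -> C) (g : borel Y -> \bar R) :
  continuous pr -> measurable_fun [set: borel Y] g -> (forall y, 0 <= g y) ->
  (forall g : borel Y -> \bar R, measurable_fun [set: borel Y] g -> (forall y, 0 <= g y) ->
      \int[a]_z g z = \int[alpha]_z (g z * (cradius (pr z))%:E)) ->
  (forall g : borel Y -> \bar R, measurable_fun [set: borel Y] g -> (forall y, 0 <= g y) ->
      \int[n]_z g z = \int[alpha]_z (g z * (\1_(M1 pr) z)%:E)) ->
  \int[a]_z (g z * ((cradius (pr z))^-1)%:E) + \int[n]_z g z = \int[alpha]_z g z.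
Proof.
move=> cpr mg g0 aI nI.
have mV := measurable_cradiusV cpr.
have mr : measurable_fun [set: borel Y] (fun z : borel Y => (cradius (pr z))%:E).
  apply/measurable_EFinP.
  exact: (measurableT_comp cradius_measurable (continuous_borel_measurable cpr)).
have V0 z : 0 <= ((cradius (pr z))^-1)%:E :> \bar R by rewrite lee_fin invr_ge0 cradius_ge0.
have M1m : measurable (M1 pr : set (borel Y)).
  by move/measurable_EFinP in mr; exact: (measurable_preimage mr (measurable_set1 0%R)).
rewrite aI; last 2 first.
- exact: emeasurable_funM.
- by move=> y; rewrite mule_ge0.
rewrite nI// -ge0_integralD//; last 4 first.
- by move=> z _; rewrite !mule_ge0// lee_fin cradius_ge0.
- by do 2 (apply: emeasurable_funM => //).
- by move=> z _; rewrite mule_ge0// lee_fin indicE.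
- by apply: emeasurable_funM => //; apply/measurable_EFinP; exact: measurable_indic.
apply: eq_integral => z _; rewrite -muleA -EFinM indicE.
have [z0|z0] := eqVneq (cradius (pr z)) 0%R.
  by rewrite mem_set// z0 mulr0 mule0 mule1 add0e.
by rewrite memNset ?mulVf// ?mule1 ?mule0 ?adde0//; exact/eqP.
Qed.

Variable (c : Y -> \bar R).
Hypothesis mc : measurable_fun [set: borel Y] (c : borel Y -> \bar R).
Hypothesis c_ge0 : forall z, 0 <= c z.
Hypothesis c_scale : forall (l : R) (z w : C), (0 < l)%R ->
  c (cscale l z, cscale l w) = l%:E * c (z, w).
Variables (k1 k2 : R).
Hypotheses (k11 : (1 <= k1)%R) (k21 : (1 <= k2)%R).
Hypothesis c_triangle : forall z v w, c (z, w) <= k1%:E * c (z, v) + k2%:E * c (v, w).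

(** The cost inequality is the triangle inequality [c_triangle] through the
    normalised common middle point [cptr (cbase v) 1], integrated; the factors
    [k1] and [k2] being at least 1, the parts through the vertex are covered
    too. *)
Lemma plan_glue (mu1 mu2 mu3 : {finite_measure set (borel X) -> \bar R})
  (alpha beta : {finite_measure set (borel Y) -> \bar R}) :
  H1 mu1 mu2 alpha -> H1 mu2 mu3 beta ->
  exists2 gamma, H1 mu1 mu3 gamma &
    \int[gamma]_z c z <= k1%:E * \int[alpha]_z c z + k2%:E * \int[beta]_z c z.
Proof.
move=> aH bH.
have alphaK := plan_inner_regular hX aH; have betaK := plan_inner_regular hX bH.
have cfst : continuous (fst : Y -> C) by move=> z; exact: cvg_fst.
have csnd : continuous (snd : Y -> C) by move=> z; exact: cvg_snd.
have [a [aK aI aB a0]] := plan_marginal_density csnd alphaK (plan_mass2 aH).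
have [b [bK bI bB b0]] := plan_marginal_density cfst betaK (plan_mass1 bH).
have mr (pr : Y -> C) : continuous pr ->
    measurable_fun [set: borel Y] (fun z : borel Y => cradius (pr z)).
  by move=> cpr; exact: (measurableT_comp cradius_measurable (continuous_borel_measurable cpr)).
have mb (pr : Y -> C) : continuous pr ->
    measurable_fun [set: borel Y] (fun z : borel Y => cbase (pr z) : borel X).
  by move=> cpr; exact: (measurableT_comp cbase_measurable (continuous_borel_measurable cpr)).
have mM1 pr : continuous pr -> measurable (M1 pr : set (borel Y)).
  by move=> cpr; exact: (measurable_preimage (mr _ cpr) (measurable_set1 0%R)).
have [n1 [n1T n1K n1I]] := plan_residual (mM1 _ csnd) alphaK.
have [n2 [n2T n2K n2I]] := plan_residual (mM1 _ cfst) betaK.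
have oU (pr : Y -> C) : continuous pr -> open [set z | cradius (pr z) != 0%R].
  exact: open_cradius_neq0_comp.
have cq (pr : Y -> C) : continuous pr ->
    {in [set z | cradius (pr z) != 0%R], continuous (fun z => cbase (pr z))}.
  move=> cpr z; rewrite inE /= => z0.
  exact: (@continuous_comp _ _ _ pr cbase z (cpr z) (cbase_continuous_at z0)).
have [|m [mM mfst msnd mneg]] := radon_gluing hY hY hX (mb _ csnd) (mb _ cfst) _ aK bK
  (oU _ csnd) (oU _ cfst) (cq _ csnd) (cq _ cfst).
  by move=> B mB; rewrite aB// bB.
have hYY : hausdorff_space (Y * Y)%type by exact: hausdorff_prod.
have mK := Mplus_inner_regular hYY mM.
pose U := [set y : Y * Y | cradius y.1.2 != 0%R] `&` [set y : Y * Y | cradius y.2.1 != 0%R].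
have oUU : open U.
  apply: openI.
    by apply: (open_comp (f := fst) (D := [set z : Y | cradius z.2 != 0%R])) (oU _ csnd) => z _; exact: cvg_fst.
  by apply: (open_comp (f := snd) (D := [set z : Y | cradius z.1 != 0%R])) (oU _ cfst) => z _; exact: cvg_snd.
(* Rescaling is continuous on the set [U] of full measure. *)
pose psi (y : Y * Y) : Y :=
  if y \in U then (cdiv y.1.1 y.1.2, cdiv y.2.2 y.2.1) else (vertex, vertex).
have psiU y : U y -> psi y = (cdiv y.1.1 y.1.2, cdiv y.2.2 y.2.1).
  by move=> Uy; rewrite /psi mem_set.
have psiNU y : ~ U y -> psi y = (vertex, vertex) by move=> nUy; rewrite /psi memNset.
have cpsi : {in U, continuous psi}.
  move=> y /set_mem Uy; have [y1 y2] := Uy.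
  have d1 : {for y, continuous (fun y : Y * Y => cdiv y.1.1 y.1.2)}.
    apply: (@continuous_comp _ _ _ fst (fun u : Y => cdiv u.1 u.2)); first exact: cvg_fst.
    by have := @cdiv_continuous_at R X y.1.1 y.1.2 y1; rewrite -surjective_pairing.
  have d2 : {for y, continuous (fun y : Y * Y => cdiv y.2.2 y.2.1)}.
    apply: (@continuous_comp _ _ _ snd (fun u : Y => cdiv u.2 u.1)); first exact: cvg_snd.
    apply: (@continuous_comp _ _ _ (fun u : Y => (u.2, u.1)) (fun u : Y => cdiv u.1 u.2)); first exact: swap_continuous.
    exact: (@cdiv_continuous_at R X y.2.2 y.2.1 y2).
  rewrite /continuous_at psiU//; apply: cvg_trans (cvg_pair d1 d2).
  apply: near_eq_cvg.
  have : \forall x \near y, U x by apply: open_nbhs_nbhs; split.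
  by apply: filterS => x Ux; rewrite psiU.
have mpsi := measurable_borel_const_off oUU cpsi psiNU.
have mfst' : measurable_fun [set: borel (Y * Y)%type] (fst : borel (Y * Y)%type -> borel Y).
  exact: fst_borel_measurable.
have msnd' : measurable_fun [set: borel (Y * Y)%type] (snd : borel (Y * Y)%type -> borel Y).
  exact: snd_borel_measurable.
have mUc : measurable (~` U : set (borel (Y * Y)%type)).
  by apply: measurableC; exact: open_borel.
have mU0 : m (~` U) = 0.
  have e1 : m (fst @^-1` M1 snd) = 0 := etrans (mfst _ (mM1 _ csnd)) a0.
  have e2 : m (snd @^-1` M1 fst) = 0 := etrans (msnd _ (mM1 _ cfst)) b0.
  have mA := measurable_preimage mfst' (mM1 _ csnd).
  have mB := measurable_preimage msnd' (mM1 _ cfst).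
  refine (@measure0_subU _ _ _ m _ _ _ mA mB mUc _ e1 e2).
  by move=> y /not_andP[/negP|/negP]; rewrite negbK => /eqP; [left|right].
have mI1 (g : borel Y -> \bar R) : measurable_fun [set: borel Y] g -> (forall y, 0 <= g y) ->
    \int[m]_y g y.1 = \int[a]_z g z.
  move=> mg g0; have [n [nE nI]] := exists_pushforward m mfst'.
  rewrite -nI//; apply: eq_measure_integral => A mA _; rewrite nE; exact: mfst.
have mI2 (g : borel Y -> \bar R) : measurable_fun [set: borel Y] g -> (forall y, 0 <= g y) ->
    \int[m]_y g y.2 = \int[b]_z g z.
  move=> mg g0; have [n [nE nI]] := exists_pushforward m msnd'.
  rewrite -nI//; apply: eq_measure_integral => A mA _; rewrite nE; exact: msnd.
have [n [nE nI]] := exists_pushforward m mpsi.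
have nT : n setT < +oo by rewrite nE preimage_setT finite_measure_lty.
have nK : inner_regular n by exact: (inner_regular_pushforward hYY hY mpsi oUU cpsi mU0 nE mK).
pose s12 : {measure set (borel Y) -> \bar R} := measure_add n1 n2.
have s12E A : s12 A = n1 A + n2 A by exact: measure_addE.
pose s : {measure set (borel Y) -> \bar R} := measure_add n s12.
have sE A : s A = n A + s12 A by exact: measure_addE.
have sI (g : borel Y -> \bar R) : measurable_fun [set: borel Y] g -> (forall y, 0 <= g y) ->
    \int[s]_z g z = \int[m]_y g (psi y) + (\int[n1]_z g z + \int[n2]_z g z).
  by move=> mg g0; rewrite !ge0_integral_measure_add// nI.
have sT : s setT < +oo by rewrite sE s12E !lte_add_pinfty.
have sK : inner_regular s.
  apply: (inner_regular_add hY nK _ (fun A _ => sE A)).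
  exact: (inner_regular_add hY n1K n2K (fun A _ => s12E A)).
have mV1 := measurable_cradiusV csnd; have mV2 := measurable_cradiusV cfst.
have mass_meas (pr : Y -> C) (A : set (borel X)) : continuous pr -> measurable A ->
    measurable_fun [set: borel Y] (fun z : borel Y => (mass A (pr z))%:E).
  by move=> cpr mA; apply: measurable_mass_comp => //; exact: continuous_borel_measurable.
have mass_nn (pr : Y -> C) A z : 0 <= (mass A (pr z))%:E by rewrite lee_fin mass_ge0.
have V0 (z : C) : (0 <= (cradius z)^-1)%R by rewrite invr_ge0 cradius_ge0.
have ae_U (P : Y * Y -> Prop) : (forall y, U y -> cbase y.1.2 = cbase y.2.1 -> P y) ->
    {ae m, forall y, P y}.
  move=> UP; have nU : m.-negligible (~` U) by exists (~` U); split.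
  apply: (negligibleS _ (negligibleU nU mneg)) => y /= nPy.
  have [Uy|] := pselect (U y); last by left.
  by right; case: (Uy) => y1 y2; split => // q; apply: nPy; exact: UP.
have zero1 (A : set (borel X)) : measurable A -> \int[n2]_z (mass A z.1)%:E = 0.
  move=> mA; rewrite n2I; [|exact: mass_meas|exact: mass_nn].
  rewrite integral0_eq// => z _; rewrite indicE -EFinM.
  have [z0|nz0] := pselect (M1 fst z); last by rewrite memNset// mulr0.
  by rewrite /mass (z0 : cradius z.1 = 0%R) mul0r mul0r.
have zero2 (A : set (borel X)) : measurable A -> \int[n1]_z (mass A z.2)%:E = 0.
  move=> mA; rewrite n1I; [|exact: mass_meas|exact: mass_nn].
  rewrite integral0_eq// => z _; rewrite indicE -EFinM.
  have [z0|nz0] := pselect (M1 snd z); last by rewrite memNset// mulr0.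
  by rewrite /mass (z0 : cradius z.2 = 0%R) mul0r mul0r.
have marg1 (A : set (borel X)) : measurable A -> mu1 A = \int[s]_z (mass A z.1)%:E.
  move=> mA; rewrite sI; [|exact: mass_meas|exact: mass_nn].
  rewrite zero1// adde0 (plan_mass1 aH)//.
  rewrite -(integral_split csnd (mass_meas _ _ cfst mA) (mass_nn fst A) aI n1I).
  congr (_ + _); rewrite -mI1; last 2 first.
  - by apply: emeasurable_funM => //; exact: mass_meas.
  - by move=> z; rewrite mule_ge0// lee_fin.
  apply: ge0_ae_eq_integral => //.
  - apply: (measurableT_comp (f := fun z : borel Y => (mass A z.1)%:E * ((cradius z.2)^-1)%:E) _ mfst').
    by apply: emeasurable_funM => //; exact: mass_meas.
  - exact: (measurableT_comp (mass_meas _ _ cfst mA) mpsi).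
  - by move=> y _; rewrite mule_ge0// lee_fin.
  - by apply: ae_U => y Uy _ _; rewrite psiU//= /cdiv mass_cscale// mulrC EFinM.
have marg3 (A : set (borel X)) : measurable A -> mu3 A = \int[s]_z (mass A z.2)%:E.
  move=> mA; rewrite sI; [|exact: mass_meas|exact: mass_nn].
  rewrite zero2// add0e (plan_mass2 bH)//.
  rewrite -(integral_split cfst (mass_meas _ _ csnd mA) (mass_nn snd A) bI n2I).
  congr (_ + _); rewrite -mI2; last 2 first.
  - by apply: emeasurable_funM => //; exact: mass_meas.
  - by move=> z; rewrite mule_ge0// lee_fin.
  apply: ge0_ae_eq_integral => //.
  - apply: (measurableT_comp (f := fun z : borel Y => (mass A z.2)%:E * ((cradius z.1)^-1)%:E) _ msnd').
    by apply: emeasurable_funM => //; exact: mass_meas.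
  - exact: (measurableT_comp (mass_meas _ _ csnd mA) mpsi).
  - by move=> y _; rewrite mule_ge0// lee_fin.
  - by apply: ae_U => y Uy _ _; rewrite psiU//= /cdiv mass_cscale// mulrC EFinM.
have [gamma gH gI] := exists_plan hX sT sK marg1 marg3.
exists gamma => //; rewrite gI sI//.
have k10 : 0 <= k1%:E by rewrite lee_fin (le_trans _ k11).
have k20 : 0 <= k2%:E by rewrite lee_fin (le_trans _ k21).
have mcV1 : measurable_fun [set: borel Y] (fun z : borel Y => c z * ((cradius z.2)^-1)%:E).
  exact: emeasurable_funM.
have mcV2 : measurable_fun [set: borel Y] (fun z : borel Y => c z * ((cradius z.1)^-1)%:E).
  exact: emeasurable_funM.
have cV1_ge0 z : 0 <= c z * ((cradius z.2)^-1)%:E by rewrite mule_ge0// lee_fin.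
have cV2_ge0 z : 0 <= c z * ((cradius z.1)^-1)%:E by rewrite mule_ge0// lee_fin.
rewrite -(integral_split csnd mc c_ge0 aI n1I) -(integral_split cfst mc c_ge0 bI n2I).
have n1c0 : 0 <= \int[n1]_z c z by apply: integral_ge0 => z _.
have n2c0 : 0 <= \int[n2]_z c z by apply: integral_ge0 => z _.
have ac0 : 0 <= \int[a]_z (c z * ((cradius z.2)^-1)%:E) by apply: integral_ge0 => z _.
have bc0 : 0 <= \int[b]_z (c z * ((cradius z.1)^-1)%:E) by apply: integral_ge0 => z _.
have combine (x A B N M : \bar R) : 0 <= A -> 0 <= B -> 0 <= N -> 0 <= M ->
    x <= k1%:E * A + k2%:E * B -> x + (N + M) <= k1%:E * (A + N) + k2%:E * (B + M).
  move=> A0 B0 N0 M0 xAB; rewrite !ge0_muleDr// addeACA leeD//.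
  by apply: leeD; rewrite lee_pemull// lee_fin.
apply: combine => //.
rewrite -(mI1 _ mcV1)// -(mI2 _ mcV2)//.
have mD1 := measurableT_comp mcV1 mfst'; have mD2 := measurableT_comp mcV2 msnd'.
have mcpsi := measurableT_comp mc mpsi.
refine (@ae_ge0_le_integral_combination _ _ _ m _ _ _ k1%:E k2%:E mD1 mD2 mcpsi
  (fun y => cV1_ge0 y.1) (fun y => cV2_ge0 y.2) (fun y => c_ge0 (psi y)) k10 k20 _).
apply: ae_U => -[[z v] [v' w]] [/= v0 v'0] vv' _; rewrite psiU//=.
have cancel (x : C) : cradius x != 0%R -> cscale (cradius x)^-1 x = cptr (cbase x) 1.
  by move=> x0; rewrite /cscale mulVf.
apply: (le_trans (c_triangle _ (cptr (cbase v) 1) _)).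
rewrite -{1}cancel// vv' -cancel// /cdiv !c_scale ?invr_gt0 ?lt0r ?v0 ?v'0 ?cradius_ge0//.
by rewrite ![_ * c _]muleC.
Qed.

End glue_plans.

(** * The metric space of measures *)

Section power_distance.
Context {R : realType} {X : ptopologicalType}.
Hypothesis hX : hausdorff_space X.
Local Notation C := (cone X R).
Local Open Scope ereal_scope.
Variables (p : R) (rho : C -> C -> \bar R).
Hypothesis p1 : (1 <= p)%R.
Hypothesis rho_metric : extended_metric_on [set: C] rho.
Hypothesis rho_homogeneous :
  radially_1_homogeneous (fun z => rho z.1 z.2 `^ p).
Hypothesis rho_lsc :
  lower_semicontinuous (fun z : C * C => rho z.1 z.2 `^ p).

Let p0 : (0 < p)%R. Proof. by rewrite (lt_le_trans _ p1). Qed.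
Let pN0 : p != 0%R. Proof. by rewrite gt_eqF. Qed.
Let pV0 : (0 < p^-1)%R. Proof. by rewrite invr_gt0. Qed.

Let c (z : C * C) : \bar R := rho z.1 z.2 `^ p.

Let mc : measurable_fun [set: borel (C * C)%type] (c : borel (C * C)%type -> \bar R).
Proof. exact: lsc_measurable. Qed.

Let c_ge0 z : 0 <= c z. Proof. exact: poweR_ge0. Qed.

Let rho_ge0 z w : 0 <= rho z w.
Proof. by case: rho_metric => + _ _ _; apply. Qed.

Let c_eq0 z : c z = 0 -> z.1 = z.2.
Proof.
case: rho_metric => _ rho0 _ _ /poweR_eq0_eq0-/(_ (rho_ge0 _ _)).
by case: (rho0 z.1 z.2 Logic.I Logic.I).
Qed.

Let c_diag z : c (z, z) = 0.
Proof.
case: rho_metric => _ rho0 _ _; rewrite /c /=.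
by case: (rho0 z z Logic.I Logic.I) => _ ->//; rewrite poweR0r.
Qed.

Let c_sym z : c (z.2, z.1) = c z.
Proof. by case: rho_metric => _ _ sym _; rewrite /c /= sym. Qed.

Let cscaleE (l : {posnum R}) (z : C) :
  cscale l%:num z = cpt (cbase z) (l%:num * (crepr z).2%:num)%:nng%R.
Proof.
rewrite /cscale /cptr; congr cpt; apply/val_inj => /=.
by rewrite ger0_norm// mulr_ge0// cradius_ge0.
Qed.

Let c_scale (l : R) (z w : C) : (0 < l)%R ->
  c (cscale l z, cscale l w) = l%:E * c (z, w).
Proof.
move=> l0; have := rho_homogeneous (PosNum l0) (cbase z) (cbase w) (crepr z).2 (crepr w).2.
by rewrite /= !cpt_repr => <-; rewrite -!cscaleE.
Qed.

(* The numerical inequality extends to infinite distances, where the right-hand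
   side is infinite. *)
Let c_triangle (k1 k2 : R) : (1 <= k1)%R -> (1 <= k2)%R ->
  (forall a b : R, 0 <= a -> 0 <= b -> (a + b) `^ p <= k1 * a `^ p + k2 * b `^ p)%R ->
  forall z v w, c (z, w) <= k1%:E * c (z, v) + k2%:E * c (v, w).
Proof.
move=> k11 k21 k12 z v w.
have k10 : (0 < k1)%R by rewrite (lt_le_trans _ k11).
have k20 : (0 < k2)%R by rewrite (lt_le_trans _ k21).
have zvw : rho z w <= rho z v + rho v w by case: rho_metric => _ _ _; apply.
apply: (@le_trans _ _ ((rho z v + rho v w) `^ p)).
  by apply: gt0_ler_poweR; rewrite ?in_itv/= ?leey ?rho_ge0 ?adde_ge0// ltW.
rewrite /c /=; have := rho_ge0 z v; have := rho_ge0 v w.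
case: (rho z v) => [a| |]//; case: (rho v w) => [b| |]// b0 a0.
- by rewrite -EFinD !poweR_EFin -!EFinM -EFinD lee_fin k12.
- by rewrite poweRyr// gt0_muley ?lte_fin// addey ?leey// -EFinM.
- by rewrite poweRyr// gt0_muley ?lte_fin// addye ?leey// -EFinM.
- by rewrite poweRyr// !gt0_muley ?lte_fin.
Qed.

Let W (mu nu : {finite_measure set (borel X) -> \bar R}) : \bar R :=
  ereal_inf [set \int[alpha]_z (rho z.1 z.2 `^ p) | alpha in H1 mu nu].

Let W_ge0 mu nu : 0 <= W mu nu.
Proof.
by apply: le_ereal_inf_tmp => _ [a _ <-]; apply: integral_ge0 => z _; exact: c_ge0.
Qed.

Let W_le mu nu alpha : H1 mu nu alpha -> W mu nu <= \int[alpha]_z c z.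
Proof. by move=> aH; apply: ereal_inf_lbound; exists alpha. Qed.

Let W_lt mu nu x : W mu nu < x -> exists2 alpha, H1 mu nu alpha & \int[alpha]_z c z < x.
Proof. by move=> /ereal_inf_lt[_ [alpha aH <-] ax]; exists alpha. Qed.

Let DE mu nu : Dcone rho p mu nu = W mu nu `^ p^-1.
Proof. by []. Qed.

Let W0 mu nu : Dcone rho p mu nu = 0 -> W mu nu = 0.
Proof. by rewrite DE => /poweR_eq0_eq0; apply. Qed.

Let D_le mu nu (A : R) : (0 <= A)%R -> W mu nu <= (A `^ p)%:E -> Dcone rho p mu nu <= A%:E.
Proof.
move=> A0 WA; rewrite DE.
have -> : A%:E = (A `^ p)%:E `^ p^-1.
  by rewrite poweR_EFin -powRrM mulfV// powRr1.
by apply: gt0_ler_poweR; rewrite ?in_itv/= ?leey ?W_ge0 ?lee_fin ?powR_ge0// ltW.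
Qed.

Let W_lt_pow mu nu (A : R) : (0 <= A)%R -> Dcone rho p mu nu < A%:E -> W mu nu < (A `^ p)%:E.
Proof.
move=> A0; rewrite DE; apply: contraTT; rewrite -!leNgt => AW.
have -> : A%:E = (A `^ p)%:E `^ p^-1.
  by rewrite poweR_EFin -powRrM mulfV// powRr1.
by apply: gt0_ler_poweR; rewrite ?in_itv/= ?leey ?W_ge0 ?lee_fin ?powR_ge0// ltW.
Qed.

Lemma Dcone_eq0 mu nu : Mplus X R mu -> Mplus X R nu ->
  Dcone rho p mu nu = 0 <-> mu = nu.
Proof.
move=> muM nuM; split => [D0|<-]; last first.
  have [alpha aH a0] := diagonal_plan hX mc c_ge0 muM c_diag.
  apply/eqP; rewrite eq_le poweR_ge0 andbT; apply: D_le => //.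
  by rewrite powR0//; have := W_le aH; rewrite a0.
have small (e : R) : (0 < e)%R -> exists2 alpha, H1 mu nu alpha & \int[alpha]_z c z <= e%:E.
  move=> e0; have [|alpha aH /ltW ae] := @W_lt mu nu e%:E; first by rewrite W0.
  by exists alpha.
have small' (e : R) : (0 < e)%R -> exists2 alpha, H1 nu mu alpha & \int[alpha]_z c z <= e%:E.
  move=> /small[alpha aH ae]; have [beta bH bI] := plan_swap hX mc c_ge0 c_sym aH.
  by exists beta => //; rewrite bI.
apply: Mplus_eq => // A mA; apply/eqP; rewrite eq_le.
by rewrite (plan_cost0_le hX rho_lsc c_ge0 c_eq0 c_scale muM nuM small mA)
  (plan_cost0_le hX rho_lsc c_ge0 c_eq0 c_scale nuM muM small' mA).
Qed.

Lemma Dcone_sym mu nu : Dcone rho p mu nu = Dcone rho p nu mu.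
Proof.
have W_swap a b : W a b <= W b a.
  apply: le_ereal_inf_tmp => _ [alpha aH <-].
  have [beta bH bI] := plan_swap hX mc c_ge0 c_sym aH.
  by apply: le_trans (W_le bH) _; rewrite bI.
by rewrite !DE; congr (_ `^ _); apply/eqP; rewrite eq_le !W_swap.
Qed.

(** Plans of cost less than [a `^ p] and [b `^ p] are composed with the weights
    of [powR_weighted_convexity] for exactly these [a] and [b]; the composed
    plan then costs at most [(a + b) `^ p]. *)
Lemma Dcone_triangle mu1 mu2 mu3 :
  Dcone rho p mu1 mu3 <= Dcone rho p mu1 mu2 + Dcone rho p mu2 mu3.
Proof.
have [->|D12] := eqVneq (Dcone rho p mu1 mu2) +oo.
  by rewrite addye ?leey// gt_eqF// (lt_le_trans _ (poweR_ge0 _ _)).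
have [->|D23] := eqVneq (Dcone rho p mu2 mu3) +oo.
  by rewrite addey ?leey// gt_eqF// (lt_le_trans _ (poweR_ge0 _ _)).
have fin_num_D mu nu : Dcone rho p mu nu != +oo -> Dcone rho p mu nu \is a fin_num.
  by move=> D; rewrite ge0_fin_numE ?poweR_ge0// ltey.
apply/lee_addgt0Pr => e e0; have e20 : (0 < e / 2)%R by rewrite divr_gt0.
pose a := (fine (Dcone rho p mu1 mu2) + e / 2)%R.
pose b := (fine (Dcone rho p mu2 mu3) + e / 2)%R.
have a0 : (0 < a)%R by rewrite ltr_wpDl// fine_ge0// poweR_ge0.
have b0 : (0 < b)%R by rewrite ltr_wpDl// fine_ge0// poweR_ge0.
have Da : Dcone rho p mu1 mu2 < a%:E.
  by rewrite -[ltLHS]fineK ?fin_num_D// lte_fin ltrDl.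
have Db : Dcone rho p mu2 mu3 < b%:E.
  by rewrite -[ltLHS]fineK ?fin_num_D// lte_fin ltrDl.
have [alpha aH /ltW aI] := W_lt (W_lt_pow (ltW a0) Da).
have [beta bH /ltW bI] := W_lt (W_lt_pow (ltW b0) Db).
have [k1 [k2 [k11 k21 k12 kab]]] := powR_weighted_convexity p1 a0 b0.
have [gamma gH gI] := plan_glue hX mc c_ge0 c_scale k11 k21
  (c_triangle k11 k21 k12) aH bH.
have -> : Dcone rho p mu1 mu2 + Dcone rho p mu2 mu3 + e%:E = (a + b)%:E.
  rewrite -(fineK (fin_num_D _ _ D12)) -(fineK (fin_num_D _ _ D23)) -!EFinD.
  by rewrite /a /b addrACA -splitr.
apply: D_le; first by rewrite addr_ge0// ltW.
apply: (le_trans (W_le gH)); apply: (le_trans gI).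
have -> : ((a + b) `^ p)%:E = k1%:E * (a `^ p)%:E + k2%:E * (b `^ p)%:E.
  by rewrite -!EFinM -EFinD kab.
have k10 : 0 <= k1%:E by rewrite lee_fin (le_trans _ k11).
have k20 : 0 <= k2%:E by rewrite lee_fin (le_trans _ k21).
exact: leeD (lee_wpmul2l k10 aI) (lee_wpmul2l k20 bI).
Qed.

Lemma Dcone_lty mu nu : Mplus_rho rho p mu -> Mplus_rho rho p nu ->
  Dcone rho p mu nu < +oo.
Proof.
move=> [muM muc] [nuM nuc].
have [alpha aH aI] := vertex_plan hX mc c_ge0 muM nuM.
apply: poweR_lty; apply: (le_lt_trans (W_le aH)); rewrite aI.
have cpt1 (x : X) : cptr x 1 = cpt x 1%:nng%R :> C.
  by rewrite /cptr; congr cpt; apply/val_inj; rewrite /= normr1.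
apply: lte_add_pinfty.
  by under eq_integral do rewrite cpt1.
under eq_integral do rewrite cpt1.
by under eq_integral do rewrite (c_sym (cpt _ 1%:nng%R, vertex)).
Qed.

End power_distance.

Theorem theorem4 (R : realType) (X : ptopologicalType)
  (Xhausdorff : hausdorff_space X) (Xcreg : completely_regular_space X)
  (p : R) (p1 : 1 <= p)
  (rho : cone X R -> cone X R -> \bar R)
  (rho_metric : extended_metric_on [set: cone X R] rho)
  (rho_homogeneous :
     radially_1_homogeneous (fun z => (rho z.1 z.2 `^ p)%E))
  (rho_proper : proper_cost (fun z => (rho z.1 z.2 `^ p)%E))
  (rho_lsc : lower_semicontinuous
     (fun z : cone X R * cone X R => (rho z.1 z.2 `^ p)%E)) :
  extended_metric_on (Mplus X R) (Dcone rho p) /\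
  metric_on (Mplus_rho rho p) (Dcone rho p).
Proof.
have ext (S : set {finite_measure set (borel X) -> \bar R}) :
    S `<=` Mplus X R -> extended_metric_on S (Dcone rho p).
  move=> SM; split.
  - by move=> mu nu _ _; exact: poweR_ge0.
  - by move=> mu nu /SM muM /SM nuM; exact: Dcone_eq0.
  - by move=> mu nu _ _; exact: Dcone_sym.
  - by move=> mu1 mu2 mu3 _ _ _; exact: Dcone_triangle.
split; first exact: ext.
split; first by apply: ext => mu [].
by move=> mu nu; exact: Dcone_lty.
Qed.
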